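(* Under the standing assumptions below, let $\lambda=(\lambda_n)\in c_H$ and suppose the sequence $k(\lambda)=(k_n(\lambda))$ is well defined (all infinite products converge) and belongs to $X^*$, i.e., $x\mapsto\sum_{n=1}^\infty k_n(\lambda)x_n$ is a well-defined bounded linear functional on $X$. Then, with $T_{k(\lambda)}=A+b\,k(\lambda)$, $$\Sigma(T_{k(\lambda)})=\{\lambda_n\mid n\in\mathbb{N}_0\},\qquad\text{where }\lambda_0:=0.$$
   Context: $X$ is one of $\ell^p$ ($1\le p\le\infty$), $c$, $c_0$ (complex sequences; $c,c_0$ with the sup norm). Standing assumptions: $a=(a_n)$ is a strictly decreasing sequence of positive reals with $a_n\to0$; $b=(b_n)\in X$ with $b_n\neq0$ for all $n$. $A:X\to X$ is $(x_n)\mapsto(a_nx_n)$, and for a functional $k$, $T_k:=A+bk$, $x\mapsto Ax+(kx)b$. $H:=\{z\in\mathbb{C}\mid\operatorname{re} z\le 0\}$ and $c_H:=\{(\lambda_n)\in c_0\mid \lambda_n\in H\ \forall n\}$. For $\lambda\in c_H$, $$k_n(\lambda):=-\frac{a_n-\lambda_n}{b_n}\prod_{m\ge1,\,m\neq n}\frac{1-\lambda_m/a_n}{1-a_m/a_n},\quad n\in\mathbb{N}.$$ $\mathbb{N}_0=\{0,1,2,\dots\}$. *)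

(* Defs.v *)
From Stdlib Require Import Reals.
From Coquelicot Require Import Coquelicot.

Open Scope R_scope.

(* Real power t^p for t >= 0 with the convention 0^p = 0 (p > 0). *)
Definition rpow (t p : R) : R :=
  match Rlt_dec 0 t with left _ => Rpower t p | right _ => 0 end.

(* The sequence spaces: l^p (1 <= p < oo), l^oo, c, c_0 (complex sequences).
   Sequences are indexed by nat starting at 0 (paper's index n >= 1 is n-1). *)
Inductive seqspace : Type :=
  | Lp (p : R)
  | Linf
  | Cconv
  | Czero.

Definition valid_space (X : seqspace) : Prop :=
  match X with Lp p => 1 <= p | _ => True end.

Definition inX (X : seqspace) (x : nat -> C) : Prop :=
  match X with
  | Lp p => ex_series (fun n => rpow (Cmod (x n)) p)
  | Linf => exists M : R, forall n, Cmod (x n) <= M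
  | Cconv => exists l : C, filterlim x eventually (locally l)
  | Czero => filterlim x eventually (locally (RtoC 0))
  end.

Definition supnorm (x : nat -> C) : R :=
  real (Lub_Rbar (fun r => exists n, r = Cmod (x n))).

Definition normX (X : seqspace) (x : nat -> C) : R :=
  match X with
  | Lp p => rpow (Series (fun n => rpow (Cmod (x n)) p)) (/ p)
  | _ => supnorm x
  end.

(* Value of a complex series (componentwise; equals the sum when it converges). *)
Definition csum (u : nat -> C) : C :=
  (Series (fun n => fst (u n)), Series (fun n => snd (u n))).

Fixpoint cprod (f : nat -> C) (N : nat) : C :=
  match N with
  | O => RtoC 1
  | S N' => Cmult (cprod f N') (f N')
  end.

Definition kfactor (a : nat -> R) (lam : nat -> C) (n m : nat) : C :=
  if Nat.eqb m n then RtoC 1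
  else Cdiv (Cminus (RtoC 1) (Cdiv (lam m) (RtoC (a n))))
            (Cminus (RtoC 1) (RtoC (a m / a n))).

Definition kpartial (a : nat -> R) (lam : nat -> C) (n N : nat) : C :=
  cprod (kfactor a lam n) N.

Definition is_kseq (a : nat -> R) (b lam kv : nat -> C) : Prop :=
  forall n, exists P : C,
    filterlim (kpartial a lam n) eventually (locally P) /\
    kv n = Cmult (Copp (Cdiv (Cminus (RtoC (a n)) (lam n)) (b n))) P.

Definition in_dual (X : seqspace) (kv : nat -> C) : Prop :=
  (forall x, inX X x -> ex_series (fun n => Cmult (kv n) (x n))) /\
  exists M : R, forall x, inX X x ->
    Cmod (csum (fun n => Cmult (kv n) (x n))) <= M * normX X x.

Definition Tk (a : nat -> R) (b kv : nat -> C) (x : nat -> C) : nat -> C :=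
  fun n => Cplus (Cmult (RtoC (a n)) (x n))
                 (Cmult (csum (fun m => Cmult (kv m) (x m))) (b n)).

Definition shift (T : (nat -> C) -> (nat -> C)) (z : C) (x : nat -> C) : nat -> C :=
  fun n => Cminus (T x n) (Cmult z (x n)).

Definition spectrum (X : seqspace) (T : (nat -> C) -> (nat -> C)) (z : C) : Prop :=
  ~ exists S : (nat -> C) -> (nat -> C),
      (forall y, inX X y -> inX X (S y)) /\
      (exists M : R, forall y, inX X y -> normX X (S y) <= M * normX X y) /\
      (forall x, inX X x -> S (shift T z x) = x) /\
      (forall y, inX X y -> shift T z (S y) = y).

(* Main.v *)
(** A point [z] outside [{0} U {a_n}] is in the spectrum of [A + bk] iff
    [f z = 1 + k ((A - z)^-1 b)] vanishes. The N-th partial product of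
    [prod_m (z - lam_m) / (z - a_m)] has a partial fraction expansion whose coefficients are
    the N-th partial products defining [k_n b_n]. As [Re lam_m <= 0 < a_m < a_n] for [m > n],
    each further factor has modulus at least 1, so these coefficients are dominated by the
    [k_n b_n], which are summable because [b] is in [X] and [k] in its dual. Dominated
    convergence identifies [f] with the infinite product, which vanishes at the [lam_m]
    and nowhere else. At [z = a_j] the operator is invertible since [b_j] and [k_j] are nonzero,
    and at [z = 0] it is not bounded below: [k] kills some unit vector in the span of
    [e_n] and [e_(n+1)], on which [A + bk = A] has norm at most [a_n]. *)

Require Import Defs.
From Stdlib Require Import Reals Lra Lia Classical FunctionalExtensionality.
From Coquelicot Require Import Coquelicot.

(** * Real series and Tannery's theorem *)

(** The obstacle is that the products in [is_kseq] converge only along their partial products: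
    absolute convergence is not assumed, and a limit 0 is not excluded in advance. The sign of
    [Re lam_m] compensates for both. The squared modulus of [1 - lam_m / a_0] is [1 + 2 |Re lam_m| /
    a_0 + |lam_m|^2 / a_0^2], so convergence of the single product at [a_0] already forces [a_m],
    [|Re lam_m|] and [|lam_m|^2] to be summable. This is why nonvanishing of [f] at [z] is proved
    with a companion point [z'] that cancels the first-order imaginary terms.

    The inverses are explicit: off the poles, the Sherman-Morrison formula; at [a_j], where
    [A - a_j] is itself singular, the equation is solved coordinate by coordinate. *)

Fixpoint psum (u : nat -> R) (N : nat) : R :=
  match N with O => 0 | S N' => psum u N' + u N' end.

Lemma psum_sum_n (u : nat -> R) (N : nat) : psum u (S N) = sum_n u N.
Proof.
  induction N as [|N IH].
  - rewrite sum_O. simpl. ring.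
  - rewrite sum_Sn, <- IH. reflexivity.
Qed.

Lemma is_series_psum (u : nat -> R) (l : R) :
  is_series u l <-> is_lim_seq (psum u) l.
Proof.
  split; intros H.
  - apply is_lim_seq_incr_1. apply is_lim_seq_ext with (sum_n u).
    + intros n. symmetry. apply psum_sum_n.
    + exact H.
  - apply is_lim_seq_incr_1 in H.
    apply (is_lim_seq_ext _ (sum_n u)) in H; [exact H | apply psum_sum_n].
Qed.

Lemma psum_le (u v : nat -> R) (N : nat) :
  (forall n, (n < N)%nat -> u n <= v n) -> psum u N <= psum v N.
Proof.
  induction N as [|N IH]; intros H; simpl; [lra|].
  apply Rplus_le_compat; [apply IH; intros; apply H; lia | apply H; lia].
Qed.

Lemma psum_eq (u v : nat -> R) (N : nat) :
  (forall n, (n < N)%nat -> u n = v n) -> psum u N = psum v N.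
Proof.
  intros H. apply Rle_antisym; apply psum_le; intros; rewrite H; auto; lra.
Qed.

Lemma psum_scal (c : R) (u : nat -> R) (N : nat) :
  psum (fun n => c * u n) N = c * psum u N.
Proof. induction N as [|N IH]; simpl; [ring | rewrite IH; ring]. Qed.

Lemma psum_diff_le (u g : nat -> R) (K N : nat) :
  (K <= N)%nat -> (forall n, Rabs (u n) <= g n) ->
  Rabs (psum u N - psum u K) <= psum g N - psum g K.
Proof.
  intros HKN H. induction HKN as [|N HKN IH]; simpl.
  - rewrite !Rminus_diag, Rabs_R0. lra.
  - replace (psum u N + u N - psum u K) with ((psum u N - psum u K) + u N) by ring.
    eapply Rle_trans; [apply Rabs_triang|]. specialize (H N). lra.
Qed.

Lemma psum_incr (g : nat -> R) (K N : nat) :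
  (forall n, 0 <= g n) -> (K <= N)%nat -> psum g K <= psum g N.
Proof.
  intros H HKN. induction HKN as [|N HKN IH]; simpl; [lra|].
  specialize (H N). lra.
Qed.

Lemma ex_series_psum_bound (u : nat -> R) (B : R) :
  (forall n, 0 <= u n) -> (forall N, psum u N <= B) -> ex_series u.
Proof.
  intros Hu HB.
  destruct (ex_finite_lim_seq_incr (psum u) B) as [l Hl].
  - intros n. simpl. specialize (Hu n). lra.
  - exact HB.
  - exists l. apply is_series_psum, Hl.
Qed.

Lemma psum_le_Series (u : nat -> R) (N : nat) :
  (forall n, 0 <= u n) -> ex_series u -> psum u N <= Series u.
Proof.
  intros Hu Hex. apply Series_correct, is_series_psum in Hex.
  apply (is_lim_seq_incr_compare _ _ Hex).
  intros n. simpl. specialize (Hu n). lra.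
Qed.

Lemma Series_ge_0 (u : nat -> R) : (forall n, 0 <= u n) -> ex_series u -> 0 <= Series u.
Proof. exact (psum_le_Series u 0). Qed.

Lemma is_series_eventually_zero (u : nat -> R) (N : nat) :
  (forall n, (N <= n)%nat -> u n = 0) -> is_series u (psum u N).
Proof.
  intros H. apply is_series_psum.
  apply is_lim_seq_ext_loc with (fun _ => psum u N); [|apply is_lim_seq_const].
  exists N. intros n Hn. induction Hn as [|n Hn IH]; simpl; [easy|].
  rewrite <- IH, (H n Hn). ring.
Qed.

Lemma Series_eventually_zero (u : nat -> R) (N : nat) :
  (forall n, (N <= n)%nat -> u n = 0) -> Series u = psum u N.
Proof. intros H. now apply is_series_unique, is_series_eventually_zero. Qed.

Lemma ex_series_le_scal (u v : nat -> R) (c : R) :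
  (forall n, Rabs (u n) <= c * v n) -> ex_series v -> ex_series u.
Proof.
  intros H Hv. apply (ex_series_le u (fun n => c * v n)); [exact H|].
  apply (ex_series_scal_l c v Hv).
Qed.

(** Dominated convergence for sums whose length grows with the row index: the head up to a fixed [K]
    converges termwise, and [g] controls the tails uniformly in the row. *)
Lemma tannery (u : nat -> nat -> R) (v g : nat -> R) :
  ex_series g -> (forall N n, Rabs (u N n) <= g n) ->
  (forall n, is_lim_seq (fun N => u N n) (v n)) ->
  is_series v (Series v) /\ is_lim_seq (fun N => psum (u N) N) (Series v).
Proof.
  intros Hg Hug Huv.
  assert (Hg0 : forall n, 0 <= g n).
  { intros n. apply Rle_trans with (2 := Hug O n), Rabs_pos. }
  assert (Hvg : forall n, Rabs (v n) <= g n).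
  { intros n.
    assert (H := is_lim_seq_abs _ _ (Huv n)).
    apply (is_lim_seq_le _ _ _ (g n) (fun N => Hug N n) H), is_lim_seq_const. }
  assert (Hv : ex_series v).
  { apply (ex_series_le v g); [exact Hvg | exact Hg]. }
  split; [apply Series_correct, Hv|].
  assert (Hvs := Series_correct _ Hv). apply is_series_psum in Hvs.
  assert (Hgs := Series_correct _ Hg). apply is_series_psum in Hgs.
  apply is_lim_seq_spec. intros eps.
  (* Four errors share [eps]: the rows and [v] beyond [K], the difference of their heads up to [K],
     and the remainder of [v] beyond [N]. *)
  assert (He : 0 < eps / 4) by (destruct eps; simpl; lra).
  apply is_lim_seq_spec in Hgs. destruct (Hgs (mkposreal _ He)) as [K HK].
  simpl in HK. specialize (HK K (le_n K)).
  assert (HKr : Series g - psum g K < eps / 4)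
    by (apply Rabs_def2 in HK; lra).
  assert (Hpu : is_lim_seq (fun N => psum (u N) K) (psum v K)).
  { clear - Huv. induction K as [|K IH]; simpl; [apply is_lim_seq_const|].
    apply is_lim_seq_plus'; [exact IH | apply Huv]. }
  apply is_lim_seq_spec in Hpu. destruct (Hpu (mkposreal _ He)) as [N1 HN1].
  simpl in HN1.
  apply is_lim_seq_spec in Hvs. destruct (Hvs (mkposreal _ He)) as [N2 HN2].
  simpl in HN2.
  exists (Nat.max K (Nat.max N1 N2)). intros N HN.
  assert (HKN : (K <= N)%nat) by lia.
  assert (H1 := psum_diff_le (u N) g K N HKN (Hug N)).
  assert (H2 := psum_diff_le v g K N HKN Hvg).
  assert (H3 := psum_le_Series g N Hg0 Hg).
  specialize (HN1 N ltac:(lia)). specialize (HN2 N ltac:(lia)).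
  revert H1 H2 HN1 HN2. unfold Rabs. repeat destruct Rcase_abs; lra.
Qed.

(** * Powers of nonnegative reals *)

Lemma rpow_pos (t p : R) : 0 < t -> rpow t p = Rpower t p.
Proof. intros H. unfold rpow. destruct (Rlt_dec 0 t); [easy | lra]. Qed.

Lemma rpow_0 (p : R) : rpow 0 p = 0.
Proof. unfold rpow. destruct (Rlt_dec 0 0); [lra | easy]. Qed.

Lemma rpow_ge_0 (t p : R) : 0 <= rpow t p.
Proof.
  unfold rpow. destruct (Rlt_dec 0 t); [|lra]. left. apply exp_pos.
Qed.

Lemma rpow_le (s t p : R) : 0 <= p -> s <= t -> rpow s p <= rpow t p.
Proof.
  intros Hp Hst. unfold rpow at 1. destruct (Rlt_dec 0 s).
  - rewrite rpow_pos by lra. apply Rle_Rpower_l; lra.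
  - apply rpow_ge_0.
Qed.

Lemma rpow_mult (s t p : R) :
  0 <= s -> 0 <= t -> rpow (s * t) p = rpow s p * rpow t p.
Proof.
  intros [Hs|<-] [Ht|<-].
  - rewrite !rpow_pos by (try apply Rmult_lt_0_compat; easy).
    symmetry. apply Rpower_mult_distr; easy.
  - rewrite Rmult_0_r, rpow_0. ring.
  - rewrite Rmult_0_l, rpow_0. ring.
  - rewrite Rmult_0_l, rpow_0. ring.
Qed.

Lemma rpow_rpow_inv (t p : R) : 0 <= t -> 1 <= p -> rpow (rpow t p) (/ p) = t.
Proof.
  intros [Ht|<-] Hp; [|rewrite !rpow_0; easy].
  rewrite (rpow_pos t), rpow_pos by (try apply exp_pos; easy).
  rewrite Rpower_mult, Rinv_r by lra. apply Rpower_1, Ht.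
Qed.

(** * Limits of complex sequences *)

Definition Clim (x : nat -> C) (l : C) : Prop :=
  is_lim_seq (fun n => Cmod (Cminus (x n) l)) 0.

(** The balls of [C] are squares, so a ball of radius [eps / 2] only bounds the modulus by
    [sqrt 2 * (eps / 2)], which is still below [eps]. *)
Lemma Clim_filterlim (x : nat -> C) (l : C) :
  filterlim x eventually (locally l) <-> Clim x l.
Proof.
  split.
  - intros H. apply is_lim_seq_spec. intros eps.
    assert (He : 0 < eps / 2) by (destruct eps; simpl; lra).
    destruct (H (fun y => ball l (mkposreal _ He) y)) as [N HN].
    { exists (mkposreal _ He). easy. }
    exists N. intros n Hn. specialize (HN n Hn).
    assert (H2 := C_NormedModule_mixin_compat2 _ _ _ HN). simpl in H2.
    change (minus (x n) l) with (Cminus (x n) l) in H2.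
    rewrite Rminus_0_r, Rabs_pos_eq by apply Cmod_ge_0.
    assert (Hs : sqrt 2 < 2).
    { rewrite <- (sqrt_Rsqr 2) at 2 by lra. apply sqrt_lt_1; unfold Rsqr; lra. }
    nra.
  - intros H P [eps HP]. apply is_lim_seq_spec in H. destruct (H eps) as [N HN].
    exists N. intros n Hn. apply HP.
    apply C_NormedModule_mixin_compat1.
    specialize (HN n Hn).
    rewrite Rminus_0_r, Rabs_pos_eq in HN by apply Cmod_ge_0. exact HN.
Qed.

Lemma is_lim_seq_squeeze_0 (u v : nat -> R) :
  (forall n, 0 <= u n <= v n) -> is_lim_seq v 0 -> is_lim_seq u 0.
Proof.
  intros H Hv. apply (is_lim_seq_le_le (fun _ => 0) u v); auto using is_lim_seq_const.
Qed.

Lemma is_lim_seq_dist (u v : nat -> R) (l : R) :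
  (forall n, Rabs (u n - l) <= v n) -> is_lim_seq v 0 -> is_lim_seq u l.
Proof.
  intros H Hv.
  apply (is_lim_seq_le_le (fun n => l - v n) u (fun n => l + v n)).
  - intros n. specialize (H n). apply Rabs_le_between in H. lra.
  - replace (Finite l) with (Finite (l - 0)) by (f_equal; ring).
    apply is_lim_seq_minus'; [apply is_lim_seq_const | exact Hv].
  - replace (Finite l) with (Finite (l + 0)) by (f_equal; ring).
    apply is_lim_seq_plus'; [apply is_lim_seq_const | exact Hv].
Qed.

Lemma Clim_fst (x : nat -> C) (l : C) :
  Clim x l -> is_lim_seq (fun n => fst (x n)) (fst l).
Proof.
  apply is_lim_seq_dist. intros n.
  exact (re_le_Cmod (Cminus (x n) l)).
Qed.

Lemma im_le_Cmod (z : C) : Rabs (snd z) <= Cmod z.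
Proof. eapply Rle_trans; [apply Rmax_r | apply Rmax_Cmod]. Qed.

Lemma Clim_snd (x : nat -> C) (l : C) :
  Clim x l -> is_lim_seq (fun n => snd (x n)) (snd l).
Proof.
  apply is_lim_seq_dist. intros n.
  exact (im_le_Cmod (Cminus (x n) l)).
Qed.

Lemma Cmod_le_Rabs (z : C) : Cmod z <= Rabs (fst z) + Rabs (snd z).
Proof.
  unfold Cmod. rewrite <- (sqrt_Rsqr (Rabs (fst z) + Rabs (snd z)))
    by (assert (H1 := Rabs_pos (fst z)); assert (H2 := Rabs_pos (snd z)); lra).
  apply sqrt_le_1_alt. unfold Rsqr.
  rewrite <- !(pow2_abs (fst z)), <- !(pow2_abs (snd z)).
  assert (H1 := Rabs_pos (fst z)); assert (H2 := Rabs_pos (snd z)). nra.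
Qed.

Lemma Clim_components (x : nat -> C) (l : C) :
  is_lim_seq (fun n => fst (x n)) (fst l) ->
  is_lim_seq (fun n => snd (x n)) (snd l) -> Clim x l.
Proof.
  intros H1 H2.
  apply is_lim_seq_squeeze_0 with
    (fun n => Rabs (fst (x n) - fst l) + Rabs (snd (x n) - snd l)).
  - intros n. split; [apply Cmod_ge_0 | apply (Cmod_le_Rabs (Cminus (x n) l))].
  - replace (Finite 0) with (Finite (Rabs (fst l - fst l) + Rabs (snd l - snd l)))
      by (f_equal; rewrite !Rminus_diag, Rabs_R0; ring).
    apply is_lim_seq_plus';
      apply (is_lim_seq_abs _ (Finite _)), is_lim_seq_minus';
      auto using is_lim_seq_const.
Qed.

Lemma Clim_ext_loc (x y : nat -> C) (l : C) :
  (exists N, forall n, (N <= n)%nat -> x n = y n) -> Clim x l -> Clim y l.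
Proof.
  intros [N HN]. apply is_lim_seq_ext_loc.
  exists N. intros n Hn. rewrite HN; easy.
Qed.

Lemma Clim_const (l : C) : Clim (fun _ => l) l.
Proof.
  apply Clim_components; apply is_lim_seq_const.
Qed.

Lemma Cmod_minus_le (x y : C) : Rabs (Cmod x - Cmod y) <= Cmod (Cminus x y).
Proof.
  assert (H1 := Cmod_triangle (Cminus x y) y).
  assert (H2 := Cmod_triangle (Cminus y x) x).
  replace (Cplus (Cminus x y) y) with x in H1 by ring.
  replace (Cplus (Cminus y x) x) with y in H2 by ring.
  replace (Cminus y x) with (Copp (Cminus x y)) in H2 by ring.
  rewrite Cmod_opp in H2. apply Rabs_le. lra.
Qed.

Lemma Clim_Cmod (x : nat -> C) (l : C) :
  Clim x l -> is_lim_seq (fun n => Cmod (x n)) (Cmod l).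
Proof. apply is_lim_seq_dist. intros n. apply Cmod_minus_le. Qed.

Lemma Clim_bounded (x : nat -> C) (l : C) :
  Clim x l -> exists M, 0 <= M /\ forall n, Cmod (x n) <= M.
Proof.
  intros H. apply Clim_Cmod in H.
  assert (Hb : exists M, forall n, Rabs (Cmod (x n)) <= M).
  { destruct (filterlim_bounded (fun n => Cmod (x n))) as [M HM].
    - exists (Cmod l). exact H.
    - exists M. exact HM. }
  destruct Hb as [M HM]. exists M. split.
  - apply Rle_trans with (2 := HM O), Rabs_pos.
  - intros n. apply Rle_trans with (2 := HM n), Rle_abs.
Qed.

Lemma Clim_plus (x y : nat -> C) (l m : C) :
  Clim x l -> Clim y m -> Clim (fun n => Cplus (x n) (y n)) (Cplus l m).
Proof.
  intros Hx Hy. apply Clim_components; simpl; apply is_lim_seq_plus';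
    auto using Clim_fst, Clim_snd.
Qed.

Lemma Clim_mult (x y : nat -> C) (l m : C) :
  Clim x l -> Clim y m -> Clim (fun n => Cmult (x n) (y n)) (Cmult l m).
Proof.
  intros Hx Hy.
  assert (H1 := Clim_fst _ _ Hx). assert (H2 := Clim_snd _ _ Hx).
  assert (H3 := Clim_fst _ _ Hy). assert (H4 := Clim_snd _ _ Hy).
  apply Clim_components; simpl.
  - apply is_lim_seq_minus'; apply is_lim_seq_mult'; easy.
  - apply is_lim_seq_plus'; apply is_lim_seq_mult'; easy.
Qed.

Lemma Clim_inv (x : nat -> C) (l : C) :
  l <> RtoC 0 -> (forall n, x n <> RtoC 0) -> Clim x l ->
  Clim (fun n => Cinv (x n)) (Cinv l).
Proof.
  intros Hl Hx0 Hx.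
  assert (Hc : 0 < Cmod l) by (apply Cmod_gt_0, Hl).
  unfold Clim.
  apply is_lim_seq_ext with
    (fun n => Cmod (Cminus (x n) l) * / (Cmod (x n) * Cmod l)).
  - intros n. assert (Hn : 0 < Cmod (x n)) by (apply Cmod_gt_0, Hx0).
    rewrite <- Cmod_mult, <- Cmod_inv, <- (Cmod_opp (Cminus (x n) l)), <- Cmod_mult.
    + f_equal. field. split; [apply Hl | apply Hx0].
    + apply Cmod_gt_0. rewrite Cmod_mult. now apply Rmult_lt_0_compat.
  - replace 0 with (0 * / (Cmod l * Cmod l)) by ring.
    apply is_lim_seq_mult'; [exact Hx|].
    apply (is_lim_seq_inv _ (Finite _)).
    + apply is_lim_seq_mult'; [apply Clim_Cmod, Hx | apply is_lim_seq_const].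
    + simpl. intros [= H]. nra.
Qed.

(** * Sequence spaces and functionals *)

Definition splus (x y : nat -> C) : nat -> C := fun n => Cplus (x n) (y n).
Definition smult (d x : nat -> C) : nat -> C := fun n => Cmult (d n) (x n).
Definition sscal (c : C) (x : nat -> C) : nat -> C := fun n => Cmult c (x n).

Lemma Rbar_le_finite_between (x : Rbar) (m M : R) :
  Rbar_le m x -> Rbar_le x M -> x = Finite (real x).
Proof. destruct x; simpl; easy. Qed.

(** [supnorm] applies [real], which sends infinite values to 0, so it is the true supremum only when
    that is finite: a bound excludes plus infinity, and the term of index 0 excludes minus
    infinity. *)
Lemma supnorm_finite (x : nat -> C) (M : R) :
  (forall n, Cmod (x n) <= M) ->
  Lub_Rbar (fun r => exists n, r = Cmod (x n)) = Finite (supnorm x).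
Proof.
  intros H.
  destruct (Lub_Rbar_correct (fun r => exists n, r = Cmod (x n))) as [Hub Hlub].
  apply Rbar_le_finite_between with (Cmod (x O)) M.
  - apply Hub. now exists O.
  - apply Hlub. intros r [n ->]. apply H.
Qed.

Lemma supnorm_ge (x : nat -> C) (M : R) (n : nat) :
  (forall n, Cmod (x n) <= M) -> Cmod (x n) <= supnorm x.
Proof.
  intros H. assert (Hf := supnorm_finite x M H).
  destruct (Lub_Rbar_correct (fun r => exists n, r = Cmod (x n))) as [Hub _].
  rewrite Hf in Hub. apply (Hub (Cmod (x n))). now exists n.
Qed.

Lemma supnorm_le (x : nat -> C) (M : R) :
  (forall n, Cmod (x n) <= M) -> supnorm x <= M.
Proof.
  intros H. assert (Hf := supnorm_finite x M H).
  destruct (Lub_Rbar_correct (fun r => exists n, r = Cmod (x n))) as [_ Hlub].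
  rewrite Hf in Hlub. apply (Hlub (Finite M)). intros r [n ->]. apply H.
Qed.

Lemma Lp_coord_le (p : R) (x : nat -> C) (n : nat) :
  1 <= p -> inX (Lp p) x -> Cmod (x n) <= normX (Lp p) x.
Proof.
  intros Hp Hx. simpl in *.
  rewrite <- (rpow_rpow_inv (Cmod (x n)) p) by (try apply Cmod_ge_0; easy).
  apply rpow_le; [left; apply Rinv_0_lt_compat; lra|].
  apply Rle_trans with (psum (fun n => rpow (Cmod (x n)) p) (S n)).
  - simpl. assert (H := psum_incr (fun n => rpow (Cmod (x n)) p) 0 n
      (fun n => rpow_ge_0 _ _) ltac:(lia)). simpl in H. lra.
  - apply psum_le_Series; [intros; apply rpow_ge_0 | exact Hx].
Qed.

Lemma inX_bounded (X : seqspace) (x : nat -> C) :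
  valid_space X -> inX X x -> exists M, 0 <= M /\ forall n, Cmod (x n) <= M.
Proof.
  destruct X as [p| | |]; simpl; intros hX Hx.
  - exists (normX (Lp p) x). split; [apply rpow_ge_0|]. intros n. now apply Lp_coord_le.
  - destruct Hx as [M HM]. exists M. split; [|exact HM].
    apply Rle_trans with (2 := HM O), Cmod_ge_0.
  - destruct Hx as [l Hl]. apply Clim_filterlim in Hl.
    apply Clim_bounded with l, Hl.
  - apply Clim_filterlim in Hx. apply Clim_bounded with (RtoC 0), Hx.
Qed.

Lemma Series_rpow_le_scal (p c : R) (x y : nat -> C) :
  0 <= p -> 0 <= c -> (forall n, Cmod (x n) <= c * Cmod (y n)) ->
  ex_series (fun n => rpow (Cmod (y n)) p) ->
  ex_series (fun n => rpow (Cmod (x n)) p) /\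
  Series (fun n => rpow (Cmod (x n)) p) <=
    rpow c p * Series (fun n => rpow (Cmod (y n)) p).
Proof.
  intros Hp Hc H Hy.
  assert (Hxy : forall n, 0 <= rpow (Cmod (x n)) p <= rpow c p * rpow (Cmod (y n)) p).
  { intros n. split; [apply rpow_ge_0|].
    rewrite <- rpow_mult by (try apply Cmod_ge_0; easy). now apply rpow_le. }
  split.
  - apply ex_series_le_scal with (fun n => rpow (Cmod (y n)) p) (rpow c p); [|exact Hy].
    intros n. rewrite Rabs_pos_eq; apply Hxy.
  - rewrite <- Series_scal_l. apply Series_le; [exact Hxy|].
    apply (ex_series_scal_l (rpow c p) _ Hy).
Qed.

Lemma normX_ge_0 (X : seqspace) (x : nat -> C) :
  valid_space X -> inX X x -> 0 <= normX X x.
Proof.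
  intros hX Hx. assert (Hb := inX_bounded X x hX Hx). destruct Hb as [M [HM0 HM]].
  assert (H : 0 <= supnorm x).
  { apply Rle_trans with (Cmod (x O)); [apply Cmod_ge_0 | now apply supnorm_ge with M]. }
  destruct X; simpl; try exact H. apply rpow_ge_0.
Qed.

Lemma normX_ge_coord (X : seqspace) (x : nat -> C) (n : nat) :
  valid_space X -> inX X x -> Cmod (x n) <= normX X x.
Proof.
  intros hX Hx. destruct (inX_bounded X x hX Hx) as [M [_ HM]].
  assert (H := supnorm_ge x M n HM).
  destruct X; try exact H. now apply Lp_coord_le.
Qed.

Lemma normX_le_scal (X : seqspace) (c : R) (x y : nat -> C) :
  valid_space X -> 0 <= c -> inX X y ->
  (forall n, Cmod (x n) <= c * Cmod (y n)) -> normX X x <= c * normX X y.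
Proof.
  intros hX Hc Hy H.
  assert (Hs : supnorm x <= c * supnorm y).
  { destruct (inX_bounded X y hX Hy) as [M [HM0 HM]].
    apply supnorm_le. intros n. apply Rle_trans with (1 := H n).
    apply Rmult_le_compat_l; [easy | now apply supnorm_ge with M]. }
  destruct X as [p| | |]; simpl in *; try exact Hs.
  destruct (Series_rpow_le_scal p c x y ltac:(lra) Hc H Hy) as [_ HS].
  assert (Hip : 0 <= / p) by (left; apply Rinv_0_lt_compat; lra).
  apply Rle_trans with (1 := rpow_le _ _ (/ p) Hip HS).
  rewrite rpow_mult, rpow_rpow_inv; try easy; try apply rpow_ge_0; try lra.
  apply Series_ge_0; [intros; apply rpow_ge_0 | exact Hy].
Qed.

(** A bounded multiplier would not preserve [Cconv], hence the convergence of [d]. The multipliers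
    [1 / (a n - z)] do converge, because [a] tends to 0 and [z] is not 0. *)
Lemma inX_Clim_mult (X : seqspace) (d x : nat -> C) (l : C) :
  valid_space X -> Clim d l -> inX X x -> inX X (smult d x).
Proof.
  intros hX Hd Hx.
  destruct (Clim_bounded d l Hd) as [M [HM0 HM]].
  assert (Hle : forall n, Cmod (smult d x n) <= M * Cmod (x n)).
  { intros n. unfold smult. rewrite Cmod_mult.
    apply Rmult_le_compat_r; [apply Cmod_ge_0 | apply HM]. }
  destruct X as [p| | |]; simpl in *.
  - apply (Series_rpow_le_scal p M _ x); [lra | easy | easy | easy].
  - destruct Hx as [K HK]. exists (M * K). intros n.
    apply Rle_trans with (1 := Hle n). apply Rmult_le_compat_l; easy.
  - destruct Hx as [m Hm]. exists (Cmult l m).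
    apply Clim_filterlim. apply Clim_filterlim in Hm. now apply Clim_mult.
  - apply Clim_filterlim. apply Clim_filterlim in Hx.
    replace (RtoC 0) with (Cmult l (RtoC 0)) by ring. now apply Clim_mult.
Qed.

Lemma inX_scal (X : seqspace) (c : C) (x : nat -> C) :
  valid_space X -> inX X x -> inX X (sscal c x).
Proof. intros hX Hx. apply (inX_Clim_mult X (fun _ => c) x c); auto using Clim_const. Qed.

Lemma Rplus_le_2Rmax (s t : R) : s + t <= 2 * Rmax s t.
Proof. assert (H1 := Rmax_l s t). assert (H2 := Rmax_r s t). lra. Qed.

(** Bounding [s + t] by twice the maximum avoids convexity, so the estimate holds for exponents
    below 1 as well; it is applied both to [p] and to [/ p]. *)
Lemma rpow_plus_le (p s t : R) :
  0 <= p -> 0 <= s -> 0 <= t -> rpow (s + t) p <= rpow 2 p * (rpow s p + rpow t p).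
Proof.
  intros Hp Hs Ht.
  assert (H : rpow (s + t) p <= rpow 2 p * rpow (Rmax s t) p).
  { rewrite <- rpow_mult; [|lra|apply Rle_trans with (1 := Hs), Rmax_l].
    apply rpow_le; [easy | apply Rplus_le_2Rmax]. }
  apply Rle_trans with (1 := H). apply Rmult_le_compat_l; [apply rpow_ge_0|].
  assert (H1 := rpow_ge_0 s p). assert (H2 := rpow_ge_0 t p).
  unfold Rmax. destruct (Rle_dec s t); lra.
Qed.

Lemma Lp_plus (p : R) (x y : nat -> C) :
  1 <= p -> inX (Lp p) x -> inX (Lp p) y ->
  inX (Lp p) (splus x y) /\
  Series (fun n => rpow (Cmod (splus x y n)) p) <=
    rpow 2 p * (Series (fun n => rpow (Cmod (x n)) p)
                + Series (fun n => rpow (Cmod (y n)) p)).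
Proof.
  simpl. intros Hp Hx Hy.
  assert (Hle : forall n, 0 <= rpow (Cmod (splus x y n)) p <=
    rpow 2 p * (rpow (Cmod (x n)) p + rpow (Cmod (y n)) p)).
  { intros n. split; [apply rpow_ge_0|].
    eapply Rle_trans; [|apply rpow_plus_le; try apply Cmod_ge_0; lra].
    apply rpow_le; [lra | apply Cmod_triangle]. }
  assert (Hex : ex_series (fun n => rpow (Cmod (x n)) p + rpow (Cmod (y n)) p))
    by exact (ex_series_plus _ _ Hx Hy).
  split.
  - apply ex_series_le_scal with
      (fun n => rpow (Cmod (x n)) p + rpow (Cmod (y n)) p) (rpow 2 p); [|exact Hex].
    intros n. rewrite Rabs_pos_eq; apply Hle.
  - rewrite <- Series_plus, <- Series_scal_l by easy.
    apply Series_le; [exact Hle|]. apply (ex_series_scal_l (rpow 2 p) _ Hex).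
Qed.

Lemma inX_plus (X : seqspace) (x y : nat -> C) :
  valid_space X -> inX X x -> inX X y -> inX X (splus x y).
Proof.
  destruct X as [p| | |]; intros hX Hx Hy.
  - now apply Lp_plus.
  - destruct Hx as [M HM]. destruct Hy as [K HK]. exists (M + K). intros n.
    eapply Rle_trans; [apply Cmod_triangle|]. specialize (HM n). specialize (HK n). lra.
  - destruct Hx as [l Hl]. destruct Hy as [m Hm]. exists (Cplus l m).
    apply Clim_filterlim in Hl. apply Clim_filterlim in Hm.
    apply Clim_filterlim. now apply Clim_plus.
  - apply Clim_filterlim in Hx. apply Clim_filterlim in Hy.
    apply Clim_filterlim. replace (RtoC 0) with (Cplus (RtoC 0) (RtoC 0)) by ring.
    now apply Clim_plus.
Qed.

(* Boundedness is insensitive to the constant here, which spares Minkowski's inequality. *)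
Lemma normX_quasi_triangle (X : seqspace) :
  valid_space X -> exists K, 0 <= K /\ forall x y, inX X x -> inX X y ->
  normX X (splus x y) <= K * (normX X x + normX X y).
Proof.
  intros hX.
  assert (Hsup : forall x y, inX X x -> inX X y ->
    supnorm (splus x y) <= 1 * (supnorm x + supnorm y)).
  { intros x y Hx Hy.
    destruct (inX_bounded X x hX Hx) as [M [_ HM]].
    destruct (inX_bounded X y hX Hy) as [M' [_ HM']].
    apply supnorm_le. intros n.
    eapply Rle_trans; [apply Cmod_triangle|].
    assert (H1 := supnorm_ge x M n HM). assert (H2 := supnorm_ge y M' n HM'). lra. }
  destruct X as [p| | |]; try (exists 1; split; [lra | exact Hsup]).
  simpl in hX.
  (* The factor 2 is [rpow (rpow 2 p) (/ p)], from [Lp_plus]; the other factor is [rpow_plus_le] at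
     the exponent [/ p]. *)
  exists (2 * rpow 2 (/ p)). split.
  { assert (H := rpow_ge_0 2 (/ p)). lra. }
  intros x y Hx Hy. destruct (Lp_plus p x y hX Hx Hy) as [_ H]. simpl.
  set (sx := Series (fun n => rpow (Cmod (x n)) p)) in *.
  set (sy := Series (fun n => rpow (Cmod (y n)) p)) in *.
  assert (Hip : 0 <= / p) by (left; apply Rinv_0_lt_compat; lra).
  assert (Hsx : 0 <= sx) by (apply Series_ge_0; [intros; apply rpow_ge_0 | exact Hx]).
  assert (Hsy : 0 <= sy) by (apply Series_ge_0; [intros; apply rpow_ge_0 | exact Hy]).
  apply Rle_trans with (1 := rpow_le _ _ (/ p) Hip H).
  assert (Hrs := rpow_ge_0 2 p).
  rewrite rpow_mult, rpow_rpow_inv by lra.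
  rewrite Rmult_assoc. apply Rmult_le_compat_l; [lra|].
  apply rpow_plus_le; lra.
Qed.

Lemma inX_eventually_zero (X : seqspace) (x : nat -> C) (N : nat) :
  valid_space X -> (forall n, (N <= n)%nat -> x n = RtoC 0) -> inX X x.
Proof.
  intros hX H.
  assert (Hl : Clim x (RtoC 0)).
  { apply Clim_ext_loc with (fun _ => RtoC 0); [|apply Clim_const].
    exists N. intros n Hn. symmetry. auto. }
  destruct X as [p| | |]; simpl.
  - exists (psum (fun n => rpow (Cmod (x n)) p) N).
    apply is_series_eventually_zero. intros n Hn.
    rewrite (H n Hn), Cmod_0. apply rpow_0.
  - destruct (Clim_bounded _ _ Hl) as [M [_ HM]]. now exists M.
  - exists (RtoC 0). now apply Clim_filterlim.
  - now apply Clim_filterlim.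
Qed.

(** * Complex series and coefficient functionals *)

Lemma fst_sum_n (u : nat -> C) (n : nat) :
  fst (sum_n u n) = sum_n (fun n => fst (u n)) n.
Proof.
  induction n as [|n IH]; [now rewrite !sum_O|].
  rewrite !sum_Sn, <- IH. reflexivity.
Qed.

Lemma snd_sum_n (u : nat -> C) (n : nat) :
  snd (sum_n u n) = sum_n (fun n => snd (u n)) n.
Proof.
  induction n as [|n IH]; [now rewrite !sum_O|].
  rewrite !sum_Sn, <- IH. reflexivity.
Qed.

(** [Series] has an arbitrary value on divergent series, so linearity of [csum] is stated under this
    condition, which membership in the dual provides. *)
Definition csummable (u : nat -> C) : Prop :=
  ex_series (fun n => fst (u n)) /\ ex_series (fun n => snd (u n)).

Lemma ex_series_csummable (u : nat -> C) : ex_series u -> csummable u.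
Proof.
  intros [l Hl].
  assert (H : Clim (sum_n u) l).
  { apply is_lim_seq_spec. intros eps.
    destruct (Hl (fun y => Cmod (Cminus y l) < eps)) as [N HN].
    { apply (locally_le_locally_norm (V := C_NormedModule)).
      exists eps. intros y Hy. exact Hy. }
    exists N. intros n Hn. rewrite Rminus_0_r, Rabs_pos_eq by apply Cmod_ge_0.
    apply HN, Hn. }
  split.
  - exists (fst l). apply Clim_fst in H.
    apply (is_lim_seq_ext _ _ _ (fst_sum_n u)) in H. exact H.
  - exists (snd l). apply Clim_snd in H.
    apply (is_lim_seq_ext _ _ _ (snd_sum_n u)) in H. exact H.
Qed.

Lemma csum_ext (u v : nat -> C) : (forall n, u n = v n) -> csum u = csum v.
Proof.
  intros H. unfold csum. f_equal; apply Series_ext; intros n; now rewrite H.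
Qed.

Lemma csum_plus (u v : nat -> C) :
  csummable u -> csummable v ->
  csum (fun n => Cplus (u n) (v n)) = Cplus (csum u) (csum v).
Proof.
  intros [H1 H2] [H3 H4]. unfold csum, Cplus. simpl. f_equal; now apply Series_plus.
Qed.

Lemma csum_scal (c : C) (u : nat -> C) :
  csummable u -> csum (fun n => Cmult c (u n)) = Cmult c (csum u).
Proof.
  intros [H1 H2]. unfold csum, Cmult. simpl. f_equal.
  - rewrite Series_minus, !Series_scal_l; [easy| |];
      [apply (ex_series_scal_l (fst c) _ H1) | apply (ex_series_scal_l (snd c) _ H2)].
  - rewrite Series_plus, !Series_scal_l; [easy| |];
      [apply (ex_series_scal_l (fst c) _ H2) | apply (ex_series_scal_l (snd c) _ H1)].
Qed.

Definition funct (kv x : nat -> C) : C := csum (smult kv x).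

Lemma funct_unit (kv : nat -> C) (j : nat) (c : C) :
  funct kv (fun n => if Nat.eqb n j then c else RtoC 0) = Cmult (kv j) c.
Proof.
  (* [f] stands for [fst] and [snd], so that both components are treated at once. *)
  assert (H : forall f : C -> R, f (RtoC 0) = 0 ->
    Series (fun n => f (Cmult (kv n) (if Nat.eqb n j then c else RtoC 0)))
    = f (Cmult (kv j) c)).
  { intros f Hf.
    assert (H0 : forall n, n <> j ->
      f (Cmult (kv n) (if Nat.eqb n j then c else RtoC 0)) = 0).
    { intros n Hn. apply Nat.eqb_neq in Hn. rewrite Hn.
      replace (Cmult (kv n) (RtoC 0)) with (RtoC 0) by ring. exact Hf. }
    rewrite (Series_eventually_zero _ (S j)).
    2: { intros n Hn. apply H0. lia. }
    simpl. rewrite Nat.eqb_refl.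
    rewrite (psum_eq _ (fun n => 0 * 0)), psum_scal; [ring|].
    intros n Hn. rewrite H0 by lia. ring. }
  unfold funct, csum, smult. rewrite (H fst eq_refl), (H snd eq_refl).
  symmetry. apply surjective_pairing.
Qed.

Lemma funct_plus (X : seqspace) (kv x y : nat -> C) :
  in_dual X kv -> inX X x -> inX X y ->
  funct kv (splus x y) = Cplus (funct kv x) (funct kv y).
Proof.
  intros [Hd _] Hx Hy. unfold funct. rewrite <- csum_plus.
  - apply csum_ext. intros n. unfold smult, splus. ring.
  - apply ex_series_csummable, Hd, Hx.
  - apply ex_series_csummable, Hd, Hy.
Qed.

Lemma funct_scal (X : seqspace) (kv x : nat -> C) (c : C) :
  in_dual X kv -> inX X x -> funct kv (sscal c x) = Cmult c (funct kv x).
Proof.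
  intros [Hd _] Hx. unfold funct. rewrite <- csum_scal.
  - apply csum_ext. intros n. unfold smult, sscal. ring.
  - apply ex_series_csummable, Hd, Hx.
Qed.

Lemma funct_bounded (X : seqspace) (kv : nat -> C) :
  valid_space X -> in_dual X kv -> exists M, 0 <= M /\
  forall x, inX X x -> Cmod (funct kv x) <= M * normX X x.
Proof.
  intros hX [_ [M HM]]. exists (Rabs M). split; [apply Rabs_pos|].
  intros x Hx. apply Rle_trans with (1 := HM x Hx).
  apply Rmult_le_compat_r; [now apply normX_ge_0 | apply Rle_abs].
Qed.

(** The factor that rotates [c] onto its modulus. At [c = 0] it is 0 rather than unimodular, so
    [cphase_spec] gives only an upper bound on its modulus. *)
Definition cphase (c : C) : C := Cdiv (Cconj c) (RtoC (Cmod c)).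

Lemma cphase_spec (c : C) :
  Cmod (cphase c) <= 1 /\ Cmult c (cphase c) = RtoC (Cmod c).
Proof.
  unfold cphase. destruct (classic (c = RtoC 0)) as [->|Hc].
  - replace (Cconj (RtoC 0)) with (RtoC 0) by (unfold Cconj, RtoC; simpl; f_equal; ring).
    rewrite Cmod_0. unfold Cdiv. rewrite Cmult_0_l, Cmod_0. split; [lra | ring].
  - assert (Hp : 0 < Cmod c) by now apply Cmod_gt_0.
    assert (Hn : RtoC (Cmod c) <> RtoC 0) by (intros H; injection H; lra).
    split.
    + rewrite Cmod_div, Cmod_conj, Cmod_R, Rabs_pos_eq by (easy || lra).
      unfold Rdiv. rewrite Rinv_r; lra.
    + unfold Cdiv. rewrite Cmult_assoc, <- Cmod2_conj, RtoC_pow. simpl.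
      rewrite Cmult_1_r. field. exact Hn.
Qed.

(** Test [k] on [b] with each term rotated so that [k_n x_n] becomes [|k_n b_n|]. The rotated vector
    is truncated at [N], since changing phases can leave [Cconv]; its norm is at most that of [b],
    which bounds the partial sums uniformly. *)
Lemma dual_mult_summable (X : seqspace) (b kv : nat -> C) :
  valid_space X -> inX X b -> in_dual X kv ->
  ex_series (fun n => Cmod (smult kv b n)).
Proof.
  intros hX Hb Hk.
  destruct (funct_bounded X kv hX Hk) as [M [HM0 HM]].
  set (u := fun n => cphase (smult kv b n)).
  assert (Hu : forall n, Cmod (u n) <= 1 /\
    Cmult (smult kv b n) (u n) = RtoC (Cmod (smult kv b n)))
    by (intros n; apply cphase_spec).
  apply ex_series_psum_bound with (M * normX X b); [intros; apply Cmod_ge_0|].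
  intros N.
  set (x := fun n => if Nat.ltb n N then Cmult (b n) (u n) else RtoC 0).
  assert (Hx0 : forall n, (N <= n)%nat -> x n = RtoC 0).
  { intros n Hn. unfold x. apply Nat.ltb_ge in Hn. now rewrite Hn. }
  assert (Hx : inX X x) by now apply inX_eventually_zero with N.
  assert (Hxb : normX X x <= 1 * normX X b).
  { apply normX_le_scal; try easy; [lra|]. intros n. unfold x.
    assert (Hc := Cmod_ge_0 (b n)).
    destruct (Nat.ltb n N).
    - rewrite Cmod_mult. destruct (Hu n) as [Hu1 _]. nra.
    - rewrite Cmod_0. lra. }
  apply Rle_trans with (Cmod (funct kv x)).
  2: { apply Rle_trans with (1 := HM x Hx). apply Rmult_le_compat_l; lra. }
  apply Rle_trans with (2 := re_le_Cmod (funct kv x)).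
  apply Rle_trans with (2 := Rle_abs _).
  unfold Re, funct, csum. simpl.
  rewrite (Series_eventually_zero _ N).
  2: { intros n Hn. unfold smult. rewrite Hx0 by easy. simpl. ring. }
  apply psum_le. intros n Hn. change (Cmod (smult kv b n) <= fst (smult kv x n)).
  replace (smult kv x n) with (RtoC (Cmod (smult kv b n))); [simpl; lra|].
  destruct (Hu n) as [_ <-]. unfold smult, x.
  apply Nat.ltb_lt in Hn. rewrite Hn. symmetry. apply Cmult_assoc.
Qed.

(** * Partial fractions and summability *)

Fixpoint cpsum (u : nat -> C) (N : nat) : C :=
  match N with O => RtoC 0 | S N' => Cplus (cpsum u N') (u N') end.

Lemma cpsum_components (u : nat -> C) (N : nat) :
  cpsum u N = (psum (fun n => fst (u n)) N, psum (fun n => snd (u n)) N).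
Proof. induction N as [|N IH]; simpl; [easy|]. now rewrite IH. Qed.

(** In [partial_fractions], multiplying each fraction by a new factor [F] splits it in two, and the
    second parts share the coefficient [e]. *)
Lemma cpsum_lin (u v w : nat -> C) (F e : C) (N : nat) :
  (forall n, (n < N)%nat -> Cmult (u n) F = Cminus (v n) (Cmult e (w n))) ->
  Cmult (cpsum u N) F = Cminus (cpsum v N) (Cmult e (cpsum w N)).
Proof.
  induction N as [|N IH]; intros H; simpl; [ring|].
  rewrite Cmult_plus_distr_r, H, IH by (intros; try apply H; lia). ring.
Qed.

(** This is [(z - lam_m) / (z - a_m)] with both terms divided by [z], the form that agrees with
    [kfactor] at [z = a_n]. *)
Definition pfactor (a : nat -> R) (lam : nat -> C) (z : C) (m : nat) : C :=
  Cdiv (Cminus (RtoC 1) (Cdiv (lam m) z)) (Cminus (RtoC 1) (Cdiv (RtoC (a m)) z)).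

Lemma RtoC_neq (x y : R) : x <> y -> RtoC x <> RtoC y.
Proof. intros H E. injection E. exact H. Qed.

Lemma Cminus_neq_0 (x y : C) : x <> y -> Cminus x y <> RtoC 0.
Proof.
  intros H E. apply H. replace x with (Cplus (Cminus x y) y) by ring. rewrite E. ring.
Qed.

Lemma kfactor_pfactor (a : nat -> R) (lam : nat -> C) (n m : nat) :
  a n <> 0 -> m <> n -> kfactor a lam n m = pfactor a lam (RtoC (a n)) m.
Proof.
  intros Ha Hmn. unfold kfactor, pfactor. apply Nat.eqb_neq in Hmn.
  rewrite Hmn, RtoC_div by easy. reflexivity.
Qed.

Lemma cprod_eq (f g : nat -> C) (N : nat) :
  (forall n, (n < N)%nat -> f n = g n) -> cprod f N = cprod g N.
Proof.
  induction N as [|N IH]; intros H; simpl; [easy|].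
  rewrite IH, H by (intros; try apply H; lia). easy.
Qed.

(** Induction on [N]. The coefficient of the new pole [a_N] is the old product evaluated at [a_N],
    so the induction hypothesis is needed at [a_N] as well as at [z]; this is why [z] is quantified
    after [N]. *)
Lemma partial_fractions (a : nat -> R) (lam : nat -> C) (N : nat) :
  (forall n, a n <> 0) -> (forall m n, a m = a n -> m = n) ->
  forall z, z <> RtoC 0 -> (forall n, (n < N)%nat -> z <> RtoC (a n)) ->
  cprod (pfactor a lam z) N =
  Cminus (RtoC 1)
    (cpsum (fun n => Cdiv (Cmult (Cminus (RtoC (a n)) (lam n)) (kpartial a lam n N))
                          (Cminus (RtoC (a n)) z)) N).
Proof.
  intros Ha Hinj. induction N as [|N IH]; intros z Hz Hza; simpl; [ring|].
  assert (HaN : RtoC (a N) <> RtoC 0) by apply RtoC_neq, Ha.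
  assert (HN : forall n, (n < N)%nat -> RtoC (a N) <> RtoC (a n)).
  { intros n Hn E. injection E. intros E'. apply Hinj in E'. lia. }
  assert (HkN : kpartial a lam N (S N) = cprod (pfactor a lam (RtoC (a N))) N).
  { unfold kpartial. simpl. unfold kfactor at 2. rewrite Nat.eqb_refl, Cmult_1_r.
    apply cprod_eq. intros n Hn. apply kfactor_pfactor; [easy | lia]. }
  rewrite HkN, (IH (RtoC (a N)) HaN HN), (IH z Hz) by (intros; apply Hza; lia).
  set (u := fun n => Cdiv (Cmult (Cminus (RtoC (a n)) (lam n)) (kpartial a lam n N))
                          (Cminus (RtoC (a n)) z)).
  set (w := fun n => Cdiv (Cmult (Cminus (RtoC (a n)) (lam n)) (kpartial a lam n N))
                          (Cminus (RtoC (a n)) (RtoC (a N)))).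
  match goal with |- context [Cplus (cpsum ?v' N) _] => set (v := v') end.
  set (e := Cdiv (Cminus (RtoC (a N)) (lam N)) (Cminus (RtoC (a N)) z)).
  assert (HzN : Cminus (RtoC (a N)) z <> RtoC 0).
  { apply Cminus_neq_0. intros E. apply (Hza N); [lia | easy]. }
  assert (HF : pfactor a lam z N = Cminus (RtoC 1) e).
  { unfold pfactor, e. field. repeat split; try easy.
    apply Cminus_neq_0, Hza. lia. }
  assert (Hsum : Cmult (cpsum u N) (pfactor a lam z N)
                 = Cminus (cpsum v N) (Cmult e (cpsum w N))).
  (* With [F] the new factor, the termwise identity is [F(z) / (a_n - z) = F(a_n) / (a_n - z) - e /
     (a_n - a_N)]. *)
  { apply cpsum_lin. intros n Hn.
    assert (HnN : RtoC (a n) <> RtoC (a N)) by (intros E; now apply (HN n Hn)).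
    assert (Hzn : z <> RtoC (a n)) by (apply Hza; lia).
    assert (HzN' : z <> RtoC (a N)) by (apply Hza; lia).
    unfold u, v, w, kpartial. simpl cprod.
    assert (Han : RtoC (a n) <> RtoC 0) by apply RtoC_neq, Ha.
    rewrite kfactor_pfactor by (easy || lia). unfold pfactor, e. field.
    repeat split; try easy; apply Cminus_neq_0; congruence. }
  replace (Cmult (Cminus (RtoC 1) (cpsum u N)) (pfactor a lam z N))
    with (Cminus (pfactor a lam z N) (Cmult (cpsum u N) (pfactor a lam z N))) by ring.
  rewrite Hsum, HF. unfold e. field. easy.
Qed.

(** * Lower bounds for the moduli of the factors *)

Lemma decreasing_lt (a : nat -> R) :
  (forall n, a (S n) < a n) -> forall m n, (m < n)%nat -> a n < a m.
Proof.
  intros H m n Hmn. induction Hmn as [|n Hmn IH]; [apply H|].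
  apply Rlt_trans with (2 := IH), H.
Qed.

Lemma decreasing_inj (a : nat -> R) :
  (forall n, a (S n) < a n) -> forall m n, a m = a n -> m = n.
Proof.
  intros H m n E. destruct (Nat.lt_trichotomy m n) as [Hl|[He|Hl]]; [|easy|];
    apply (decreasing_lt a H) in Hl; lra.
Qed.

Lemma Cmod_sq (z : C) : Cmod z ^ 2 = fst z ^ 2 + snd z ^ 2.
Proof. apply Cmod2_alt. Qed.

Lemma Cmod_ge_1 (z : C) : 1 <= Cmod z ^ 2 -> 1 <= Cmod z.
Proof. intros H. assert (H0 := Cmod_ge_0 z). nra. Qed.

(** The condition [Re l <= 0] makes the cross term nonnegative. It is written with [Rabs (fst l)]
    because the series of these absolute values is the one to be bounded. *)
Lemma Cmod_one_minus_div_sq (l : C) (t : R) : 0 < t -> fst l <= 0 ->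
  Cmod (Cminus (RtoC 1) (Cdiv l (RtoC t))) ^ 2
  = 1 + 2 / t * Rabs (fst l) + / t ^ 2 * Cmod l ^ 2.
Proof.
  intros Ht Hl. rewrite !Cmod_sq, Rabs_left1 by easy.
  unfold Cdiv, Cinv, Cminus, Cplus, Copp, Cmult, RtoC. simpl. field. lra.
Qed.

Lemma sq_div (x y : R) : y <> 0 -> (x / y) ^ 2 = x ^ 2 / y ^ 2.
Proof. intros H. field. easy. Qed.

(** With [r = a_m / a_n] in [(0, 1)], the square is [(1 + s) / (1 - r)^2]. It is at least
    [1 + s + r], since [1 + s + r <= (1 + s) (1 + r)] and [(1 + r) (1 - r)^2 <= 1]. Keeping all
    three terms lets one product control three series. *)
Lemma Cmod_kfactor_ge (a : nat -> R) (lam : nat -> C) (n m : nat) :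
  (forall n, 0 < a n) -> (forall n, a (S n) < a n) -> (forall n, fst (lam n) <= 0) ->
  (n < m)%nat ->
  1 + (2 / a n * Rabs (fst (lam m)) + / a n ^ 2 * Cmod (lam m) ^ 2 + / a n * a m)
  <= Cmod (kfactor a lam n m) ^ 2.
Proof.
  intros Hpos Hdec Hlam Hnm.
  assert (Hn := Hpos n). assert (Hm := Hpos m).
  assert (Hlt := decreasing_lt a Hdec n m Hnm).
  assert (Hr : 0 < a m / a n < 1).
  { split; [now apply Rdiv_lt_0_compat|]. apply Rmult_lt_reg_r with (a n); [easy|].
    unfold Rdiv. rewrite Rmult_assoc, Rinv_l; lra. }
  unfold kfactor. destruct (Nat.eqb_spec m n) as [E|_]; [lia|].
  rewrite Cmod_div.
  2: { rewrite <- RtoC_minus. apply RtoC_neq. lra. }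
  rewrite <- RtoC_minus, Cmod_R, (Rabs_pos_eq (1 - a m / a n)) by lra.
  rewrite sq_div by lra.
  rewrite Cmod_one_minus_div_sq by easy.
  replace (/ a n * a m) with (a m / a n) by (unfold Rdiv; ring).
  set (r := a m / a n) in *.
  assert (Hs : 0 <= 2 / a n * Rabs (fst (lam m)) + / a n ^ 2 * Cmod (lam m) ^ 2).
  { apply Rplus_le_le_0_compat; apply Rmult_le_pos.
    - left. apply Rdiv_lt_0_compat; lra.
    - apply Rabs_pos.
    - left. apply Rinv_0_lt_compat, pow_lt, Hn.
    - apply pow_le, Cmod_ge_0. }
  rewrite (Rplus_assoc 1).
  set (s := 2 / a n * Rabs (fst (lam m)) + / a n ^ 2 * Cmod (lam m) ^ 2) in *.
  clearbody r s.
  apply Rmult_le_reg_r with ((1 - r) ^ 2); [apply pow_lt; lra|].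
  replace ((1 + s) / (1 - r) ^ 2 * (1 - r) ^ 2) with (1 + s) by (field; lra).
  assert (H1 : (1 + (s + r)) * (1 - r) ^ 2 <= (1 + s) * ((1 + r) * (1 - r) ^ 2)).
  { assert (0 <= s * r * (1 - r) ^ 2).
    { repeat apply Rmult_le_pos; lra. } nra. }
  assert (H2 : (1 + r) * (1 - r) ^ 2 <= 1).
  { assert (0 <= r * (1 - r)) by nra. nra. }
  nra.
Qed.

Lemma Cmod_kfactor_ge_1 (a : nat -> R) (lam : nat -> C) (n m : nat) :
  (forall n, 0 < a n) -> (forall n, a (S n) < a n) -> (forall n, fst (lam n) <= 0) ->
  (n < m)%nat -> 1 <= Cmod (kfactor a lam n m).
Proof.
  intros Hpos Hdec Hlam Hnm. apply Cmod_ge_1.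
  apply Rle_trans with (2 := Cmod_kfactor_ge a lam n m Hpos Hdec Hlam Hnm).
  assert (Hn := Hpos n). assert (Hm := Hpos m).
  assert (0 < / a n) by now apply Rinv_0_lt_compat.
  assert (0 < / a n ^ 2) by now apply Rinv_0_lt_compat, pow_lt.
  assert (0 <= Cmod (lam m) ^ 2) by apply pow_le, Cmod_ge_0.
  assert (H3 := Rabs_pos (fst (lam m))). unfold Rdiv.
  assert (0 <= / a n * Rabs (fst (lam m))) by (apply Rmult_le_pos; lra).
  assert (0 <= / a n ^ 2 * Cmod (lam m) ^ 2) by (apply Rmult_le_pos; lra).
  assert (0 <= / a n * a m) by (apply Rmult_le_pos; lra).
  nra.
Qed.

(** For [m < n] the factor itself may have modulus below 1, but its numerator still has modulus at
    least 1. *)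
Lemma kfactor_neq_0 (a : nat -> R) (lam : nat -> C) (n m : nat) :
  (forall n, 0 < a n) -> (forall n, a (S n) < a n) -> (forall n, fst (lam n) <= 0) ->
  kfactor a lam n m <> RtoC 0.
Proof.
  intros Hpos Hdec Hlam. unfold kfactor. destruct (Nat.eqb_spec m n) as [E|E].
  - apply RtoC_neq. lra.
  - assert (Hn := Hpos n).
    assert (Hd : a m / a n <> 1).
    { intros H. apply E, (decreasing_inj a Hdec).
      apply Rmult_eq_reg_r with (/ a n); [|apply Rinv_neq_0_compat; lra].
      rewrite Rinv_r by lra. exact H. }
    apply Cmod_gt_0. rewrite Cmod_div.
    2: { rewrite <- RtoC_minus. apply RtoC_neq. lra. }
    apply Rdiv_lt_0_compat.
    + apply Rlt_le_trans with 1; [lra|]. apply Cmod_ge_1.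
      rewrite Cmod_one_minus_div_sq by easy.
      assert (0 < 2 / a n) by (apply Rdiv_lt_0_compat; lra).
      assert (0 < / a n ^ 2) by now apply Rinv_0_lt_compat, pow_lt.
      assert (0 <= Cmod (lam m) ^ 2) by apply pow_le, Cmod_ge_0.
      assert (H3 := Rabs_pos (fst (lam m))). nra.
    + apply Cmod_gt_0. rewrite <- RtoC_minus. apply RtoC_neq. lra.
Qed.

Lemma cprod_neq_0 (f : nat -> C) (N : nat) :
  (forall n, f n <> RtoC 0) -> cprod f N <> RtoC 0.
Proof.
  intros H. induction N as [|N IH]; simpl; [apply RtoC_neq; lra|].
  apply Cmult_neq_0; auto.
Qed.

Lemma Cmod_cprod_le (f : nat -> C) (N N' : nat) :
  (forall m, (N <= m)%nat -> 1 <= Cmod (f m)) -> (N <= N')%nat ->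
  Cmod (cprod f N) <= Cmod (cprod f N').
Proof.
  intros H HN. induction HN as [|N' HN IH]; simpl; [lra|].
  rewrite Cmod_mult. assert (H1 := H N' HN). assert (H2 := Cmod_ge_0 (cprod f N')). nra.
Qed.

(** With [n < N], every factor still to come has index above [n], so the moduli are nondecreasing
    from [N] on. *)
Lemma Cmod_kpartial_le_limit (a : nat -> R) (lam : nat -> C) (n N : nat) (P : C) :
  (forall n, 0 < a n) -> (forall n, a (S n) < a n) -> (forall n, fst (lam n) <= 0) ->
  Clim (kpartial a lam n) P -> (n < N)%nat -> Cmod (kpartial a lam n N) <= Cmod P.
Proof.
  intros Hpos Hdec Hlam HP HnN.
  assert (H := Clim_Cmod _ _ HP).
  refine (is_lim_seq_le_loc (fun _ => Cmod (kpartial a lam n N)) _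
            (Finite _) (Finite (Cmod P)) _ (is_lim_seq_const _) H).
  exists N. intros N' HN'. apply Cmod_cprod_le; [|easy].
  intros m Hm. apply Cmod_kfactor_ge_1; auto. lia.
Qed.

Lemma kpartial_limit_neq_0 (a : nat -> R) (lam : nat -> C) (n : nat) (P : C) :
  (forall n, 0 < a n) -> (forall n, a (S n) < a n) -> (forall n, fst (lam n) <= 0) ->
  Clim (kpartial a lam n) P -> P <> RtoC 0.
Proof.
  intros Hpos Hdec Hlam HP. apply Cmod_gt_0.
  apply Rlt_le_trans with (Cmod (kpartial a lam n (S n))).
  - apply Cmod_gt_0, cprod_neq_0. intros m. now apply kfactor_neq_0.
  - apply Cmod_kpartial_le_limit; auto.
Qed.

Lemma ex_series_component (u v : nat -> R) (c : R) :
  0 < c -> (forall n, 0 <= u n) -> (forall n, c * u n <= v n) ->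
  ex_series v -> ex_series u.
Proof.
  intros Hc Hu Huv Hv. apply ex_series_le_scal with (2 := Hv) (c := / c).
  intros n. rewrite Rabs_pos_eq by easy.
  apply Rmult_le_reg_l with c; [easy|].
  rewrite <- Rmult_assoc, Rinv_r, Rmult_1_l by lra. apply Huv.
Qed.

(* Every factor of the product at [a 0] has modulus at least 1, so its mere
   convergence (absolute or not) bounds the three series. *)
Lemma kpartial_summability (a : nat -> R) (lam : nat -> C) (P : C) :
  (forall n, 0 < a n) -> (forall n, a (S n) < a n) -> (forall n, fst (lam n) <= 0) ->
  Clim (kpartial a lam 0) P ->
  ex_series a /\ ex_series (fun n => Rabs (fst (lam n))) /\
  ex_series (fun n => Cmod (lam n) ^ 2).
Proof.
  intros Hpos Hdec Hlam HP.
  set (t := fun m => 2 / a O * Rabs (fst (lam m)) + / a O ^ 2 * Cmod (lam m) ^ 2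
                     + / a O * a m).
  assert (H0 := Hpos O).
  assert (Hc1 : 0 < 2 / a O) by (apply Rdiv_lt_0_compat; lra).
  assert (Hc2 : 0 < / a O ^ 2) by now apply Rinv_0_lt_compat, pow_lt.
  assert (Hc3 : 0 < / a O) by now apply Rinv_0_lt_compat.
  assert (Hn1 : forall n, 0 <= Rabs (fst (lam n))) by (intros; apply Rabs_pos).
  assert (Hn2 : forall n, 0 <= Cmod (lam n) ^ 2) by (intros; apply pow_le, Cmod_ge_0).
  assert (Hn3 : forall n, 0 <= a n) by (intros n; left; apply Hpos).
  assert (Ht0 : forall m, 0 <= t m).
  { intros m. unfold t. assert (H1 := Hn1 m). assert (H2 := Hn2 m). assert (H3 := Hn3 m).
    repeat apply Rplus_le_le_0_compat; apply Rmult_le_pos; lra. }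
  (* The factor of index 0 is 1 by convention, so the sum starts at index 1. The step is
     [1 + S + t <= (1 + S) (1 + t)]. *)
  assert (Hlow : forall N, 1 + psum (fun m => t (S m)) N <= Cmod (kpartial a lam 0 (S N)) ^ 2).
  { induction N as [|N IH].
    - change (kpartial a lam 0 1) with (Cmult (RtoC 1) (RtoC 1)).
      rewrite Cmult_1_l, Cmod_1. simpl. lra.
    - change (kpartial a lam 0 (S (S N)))
        with (Cmult (kpartial a lam 0 (S N)) (kfactor a lam 0 (S N))).
      rewrite Cmod_mult, Rpow_mult_distr.
      assert (Hf := Cmod_kfactor_ge a lam 0 (S N) Hpos Hdec Hlam ltac:(lia)).
      fold (t (S N)) in Hf. simpl psum.
      assert (Hps : 0 <= psum (fun m => t (S m)) N).
      { apply (psum_incr (fun m => t (S m)) 0 N); [intros; apply Ht0 | lia]. }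
      specialize (Ht0 (S N)).
      apply Rle_trans with ((1 + psum (fun m => t (S m)) N) * (1 + t (S N))); [nra|].
      apply Rmult_le_compat; lra. }
  assert (Hts : ex_series t).
  { apply ex_series_incr_1. apply ex_series_psum_bound with (Cmod P ^ 2); [intros; apply Ht0|].
    intros N. assert (HN := Hlow N).
    assert (HP' := Cmod_kpartial_le_limit a lam 0 (S N) P Hpos Hdec Hlam HP ltac:(lia)).
    assert (Hsq := pow_incr _ _ 2 (conj (Cmod_ge_0 _) HP')). lra. }
  repeat split;
    [apply ex_series_component with t (/ a O) | apply ex_series_component with t (2 / a O)
    | apply ex_series_component with t (/ a O ^ 2)]; auto; intros n; unfold t;
    specialize (Hn1 n); specialize (Hn2 n); specialize (Hn3 n);
    assert (0 <= 2 / a O * Rabs (fst (lam n))) by (apply Rmult_le_pos; lra);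
    assert (0 <= / a O ^ 2 * Cmod (lam n) ^ 2) by (apply Rmult_le_pos; lra);
    assert (0 <= / a O * a n) by (apply Rmult_le_pos; lra); lra.
Qed.

(** * The characteristic function as an infinite product *)

Lemma resolvent_Clim (a : nat -> R) (z : C) :
  is_lim_seq a 0 -> z <> RtoC 0 -> (forall n, z <> RtoC (a n)) ->
  Clim (fun n => Cinv (Cminus (RtoC (a n)) z)) (Cinv (Cminus (RtoC 0) z)).
Proof.
  intros Ha Hz Hza. apply Clim_inv.
  - apply Cminus_neq_0. congruence.
  - intros n. apply Cminus_neq_0. intros E. now apply (Hza n).
  - apply (Clim_plus (fun n => RtoC (a n)) (fun _ => Copp z)); [|apply Clim_const].
    apply Clim_components; simpl; [exact Ha | apply is_lim_seq_const].
Qed.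

(** The vector [(A - z)^-1 b]; at a zero of the characteristic function it becomes an eigenvector of
    [A + bk]. *)
Definition resolv (a : nat -> R) (b : nat -> C) (z : C) : nat -> C :=
  smult (fun n => Cinv (Cminus (RtoC (a n)) z)) b.

(* Since [1 <= |kfactor n m|] for [m > n], the N-th residues are dominated by their limits
   [kv n * b n], which are summable by duality; this makes Tannery's theorem applicable. *)
Lemma product_limit (X : seqspace) (a : nat -> R) (b lam kv : nat -> C) (z : C) :
  valid_space X -> (forall n, 0 < a n) -> (forall n, a (S n) < a n) ->
  is_lim_seq a 0 -> inX X b -> (forall n, b n <> RtoC 0) ->
  (forall n, fst (lam n) <= 0) -> is_kseq a b lam kv -> in_dual X kv ->
  z <> RtoC 0 -> (forall n, z <> RtoC (a n)) ->
  Clim (cprod (pfactor a lam z)) (Cplus (RtoC 1) (funct kv (resolv a b z))).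
Proof.
  intros hX Hpos Hdec Hlim Hb Hb0 Hlam Hk Hd Hz Hza.
  destruct (Clim_bounded _ _ (resolvent_Clim a z Hlim Hz Hza)) as [M [HM0 HM]].
  set (c := fun n => smult kv b n).
  assert (Hc : ex_series (fun n => M * Cmod (c n))).
  { apply (ex_series_scal_l M (fun n => Cmod (c n))).
    exact (dual_mult_summable X b kv hX Hb Hd). }
  (* The N-th approximation of [k_n b_n], in which [b_n] has cancelled. *)
  set (d := fun N n => Copp (Cmult (Cminus (RtoC (a n)) (lam n)) (kpartial a lam n N))).
  set (r := fun n => Cinv (Cminus (RtoC (a n)) z)) in *.
  (* The rows are cut off at [N] because the domination of the residues by their limits is available
     for [n < N]. *)
  set (u := fun N n => if Nat.ltb n N then Cmult (d N n) (r n) else RtoC 0).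
  set (v := fun n => Cmult (c n) (r n)).
  assert (Hdc : forall n, Clim (fun N => d N n) (c n) /\
                  forall N, (n < N)%nat -> Cmod (d N n) <= Cmod (c n)).
  { intros n. destruct (Hk n) as [P [HP HkP]]. apply Clim_filterlim in HP.
    assert (Hcn : c n = Cmult (Copp (Cminus (RtoC (a n)) (lam n))) P).
    { unfold c, smult. rewrite HkP. field. apply Hb0. }
    rewrite Hcn. split.
    - apply Clim_ext_loc with
        (fun N => Cmult (Copp (Cminus (RtoC (a n)) (lam n))) (kpartial a lam n N)).
      + exists O. intros N _. unfold d. ring.
      + apply Clim_mult; [apply Clim_const | exact HP].
    - intros N HN. unfold d. rewrite Cmod_opp, !Cmod_mult, Cmod_opp.
      apply Rmult_le_compat_l; [apply Cmod_ge_0|].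
      now apply Cmod_kpartial_le_limit. }
  assert (Hub : forall N n, Cmod (u N n) <= M * Cmod (c n)).
  { intros N n. unfold u. destruct (Nat.ltb_spec n N) as [Hn|Hn].
    - rewrite Cmod_mult, Rmult_comm. apply Rmult_le_compat; try apply Cmod_ge_0.
      + apply HM.
      + now apply Hdc.
    - rewrite Cmod_0. apply Rmult_le_pos; [easy | apply Cmod_ge_0]. }
  assert (Huv : forall n, Clim (fun N => u N n) (v n)).
  { intros n. apply Clim_ext_loc with (fun N => Cmult (d N n) (r n)).
    - exists (S n). intros N HN. unfold u. now rewrite (proj2 (Nat.ltb_lt n N) HN).
    - apply Clim_mult; [apply Hdc | apply Clim_const]. }
  destruct (tannery (fun N n => fst (u N n)) (fun n => fst (v n)) _ Hc) as [_ H1].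
  { intros N n. apply Rle_trans with (2 := Hub N n), re_le_Cmod. }
  { intros n. now apply (Clim_fst (fun N => u N n)). }
  destruct (tannery (fun N n => snd (u N n)) (fun n => snd (v n)) _ Hc) as [_ H2].
  { intros N n. apply Rle_trans with (2 := Hub N n), im_le_Cmod. }
  { intros n. now apply (Clim_snd (fun N => u N n)). }
  assert (H : Clim (fun N => cpsum (u N) N) (csum v)).
  { apply Clim_components.
    - apply is_lim_seq_ext with (2 := H1). intros N. now rewrite cpsum_components.
    - apply is_lim_seq_ext with (2 := H2). intros N. now rewrite cpsum_components. }
  replace (funct kv (resolv a b z)) with (csum v).
  2: { apply csum_ext. intros n. unfold v, c, resolv, smult, r. ring. }
  apply Clim_ext_loc with (fun N => Cplus (RtoC 1) (cpsum (u N) N)).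
  2: { apply Clim_plus; [apply Clim_const | exact H]. }
  exists O. intros N _. rewrite partial_fractions; try easy.
  2: { intros n. specialize (Hpos n). lra. }
  2: { apply (decreasing_inj a Hdec). }
  match goal with |- _ = Cminus _ (cpsum ?w N) => set (w' := w) end.
  (* [cpsum_lin] with [F = 1], [v = 0] and [e = 1] says that the two sums are opposite. *)
  assert (Hs : Cmult (cpsum (u N) N) (RtoC 1)
               = Cminus (RtoC 0) (Cmult (RtoC 1) (cpsum w' N))).
  { replace (RtoC 0) with (cpsum (fun _ => RtoC 0) N).
    2: { clear. induction N as [|N IH]; simpl; [easy|]. rewrite IH. ring. }
    apply cpsum_lin. intros n Hn. unfold u, d, w', r.
    rewrite (proj2 (Nat.ltb_lt n N) Hn). field.
    apply Cminus_neq_0. intros E. now apply (Hza n). }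
  rewrite Cmult_1_r in Hs. rewrite Hs. ring.
Qed.

Lemma Clim_zero_unique (x : nat -> C) (l : C) :
  Clim x l -> Clim x (RtoC 0) -> l = RtoC 0.
Proof.
  intros H1 H2. apply Clim_Cmod, is_lim_seq_unique in H1, H2.
  rewrite H1 in H2. injection H2. rewrite Cmod_0. apply Cmod_eq_0.
Qed.

Lemma cprod_pfactor_zero (a : nat -> R) (lam : nat -> C) (j N : nat) :
  lam j <> RtoC 0 -> (j < N)%nat -> cprod (pfactor a lam (lam j)) N = RtoC 0.
Proof.
  intros Hj HjN. induction HjN as [|N HN IH]; simpl.
  - unfold pfactor at 2. unfold Cdiv at 2. rewrite Cinv_r by easy.
    unfold Cdiv. ring.
  - rewrite IH. ring.
Qed.

(** * Products bounded away from zero *)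

Fixpoint rprod (r : nat -> R) (N : nat) : R :=
  match N with O => 1 | S N' => rprod r N' * r N' end.

Lemma rprod_pos (r : nat -> R) (N : nat) : (forall n, 0 < r n) -> 0 < rprod r N.
Proof.
  intros H. induction N as [|N IH]; simpl; [lra|]. now apply Rmult_lt_0_compat.
Qed.

(** Weierstrass's inequality [prod (1 - e_n) >= 1 - sum e_n], applied beyond an index [M] where the
    tail of [e] is below 1/2; the head contributes the positive factor [rprod r M]. *)
Lemma rprod_eventually_ge (r e : nat -> R) :
  (forall n, 0 < r n) -> (forall n, 0 <= e n) -> (forall n, 1 - e n <= r n) ->
  ex_series e ->
  exists c M, 0 < c /\ forall N, (M <= N)%nat -> c <= rprod r N.
Proof.
  intros Hr He Hre Hex.
  assert (Hs := Series_correct _ Hex). apply is_series_psum, is_lim_seq_spec in Hs.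
  assert (Hh : 0 < 1 / 2) by lra.
  destruct (Hs (mkposreal _ Hh)) as [M HM]. simpl in HM.
  specialize (HM M (le_n M)). apply Rabs_def2 in HM.
  exists (rprod r M / 2), M. assert (HrM := rprod_pos r M Hr).
  split; [lra|].
  assert (H : forall N, (M <= N)%nat ->
    rprod r M * (1 - (psum e N - psum e M)) <= rprod r N).
  { intros N HN. induction HN as [|N HN IH]; simpl; [lra|].
    assert (HS := psum_le_Series e (S N) He Hex). simpl in HS.
    assert (Hi := psum_incr e M N He HN).
    specialize (Hr N). specialize (He N). specialize (Hre N).
    set (s := psum e N - psum e M) in *.
    assert (Hs1 : 0 <= s) by (unfold s; lra).
    assert (Hs2 : s + e N <= 1 / 2) by (unfold s; lra).
    replace (psum e N + e N - psum e M) with (s + e N) by (unfold s; ring).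
    clearbody s.
    apply Rle_trans with (rprod r M * (1 - s) * r N).
    - rewrite Rmult_assoc. apply Rmult_le_compat_l; [lra|]. nra.
    - apply Rmult_le_compat_r; lra. }
  intros N HN. apply Rle_trans with (2 := H N HN).
  assert (HS := psum_le_Series e N He Hex). nra.
Qed.

Lemma Cmod_cprod (f : nat -> C) (N : nat) :
  Cmod (cprod f N) = rprod (fun n => Cmod (f n)) N.
Proof.
  induction N as [|N IH]; simpl; [apply Cmod_1|]. now rewrite Cmod_mult, IH.
Qed.

Lemma rprod_mult (f g : nat -> R) (N : nat) :
  rprod (fun n => f n * g n) N = rprod f N * rprod g N.
Proof. induction N as [|N IH]; simpl; [ring|]. rewrite IH. ring. Qed.

(** It holds because [(1 - (h + g)) (1 + g) = 1 - h - g (h + g)]; when the left side of the claim is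
    not positive there is nothing to compare. *)
Lemma Rdiv_ge_one_minus (num den h g : R) :
  0 <= num -> 0 < den -> 0 <= h -> 0 <= g -> 1 - h <= num -> den <= 1 + g ->
  1 - (h + g) <= num / den.
Proof.
  intros Hn Hd Hh Hg Hnum Hden.
  apply Rmult_le_reg_r with den; [easy|].
  replace (num / den * den) with num by (field; lra).
  destruct (Rle_dec (1 - (h + g)) 0) as [Hle|Hgt].
  - nra.
  - apply Rnot_le_lt in Hgt. apply Rle_trans with ((1 - (h + g)) * (1 + g)); nra.
Qed.

(** The product expands to [1 - s l + w w' l^2]. As [s] is real, the real part of [1 - s l] involves
    only [Re l], so the imaginary part of [l] enters only through [|l|^2]. *)
Lemma Cmod_one_minus_mult_ge (l w w' : C) (s : R) :
  Cplus w w' = RtoC s ->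
  1 - (Rabs s * Rabs (fst l) + Cmod w * Cmod w' * Cmod l ^ 2)
  <= Cmod (Cminus (RtoC 1) (Cmult l w)) * Cmod (Cminus (RtoC 1) (Cmult l w')).
Proof.
  intros Hs. rewrite <- (Cmod_mult (Cminus _ _)).
  set (q := Cmult (Cmult l l) (Cmult w w')).
  replace (Cmult (Cminus (RtoC 1) (Cmult l w)) (Cminus (RtoC 1) (Cmult l w')))
    with (Cplus (Cminus (RtoC 1) (Cmult l (RtoC s))) q)
    by (rewrite <- Hs; unfold q; ring).
  assert (Hq : Cmod q = Cmod w * Cmod w' * Cmod l ^ 2)
    by (unfold q; rewrite !Cmod_mult; ring).
  rewrite <- Hq.
  set (y := Cminus (RtoC 1) (Cmult l (RtoC s))).
  assert (Hy : 1 - Rabs s * Rabs (fst l) <= Cmod y).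
  { apply Rle_trans with (2 := re_le_Cmod y). unfold y, Re. simpl.
    rewrite <- Rabs_mult.
    replace (1 + - (fst l * s - snd l * 0)) with (1 - s * fst l) by ring.
    unfold Rabs. repeat destruct Rcase_abs; lra. }
  assert (Ht := Cmod_triangle (Cplus y q) (Copp q)).
  replace (Cplus (Cplus y q) (Copp q)) with y in Ht by ring.
  rewrite Cmod_opp in Ht. lra.
Qed.

(** The a priori bound [A] on [t] absorbs the quadratic term, making the error linear in [t], hence
    summable along [t = a n]. *)
Lemma Cmod_one_minus_mult_le (t : R) (w w' : C) (A : R) :
  0 <= t <= A ->
  Cmod (Cminus (RtoC 1) (Cmult (RtoC t) w)) * Cmod (Cminus (RtoC 1) (Cmult (RtoC t) w'))
  <= 1 + (Cmod w + Cmod w' + A * (Cmod w * Cmod w')) * t.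
Proof.
  intros Ht.
  assert (H : forall w, Cmod (Cminus (RtoC 1) (Cmult (RtoC t) w)) <= 1 + t * Cmod w).
  { intros y. assert (Hy := Cmod_triangle (RtoC 1) (Copp (Cmult (RtoC t) y))).
    rewrite Cmod_opp, Cmod_mult, Cmod_1, Cmod_R, Rabs_pos_eq in Hy by lra. exact Hy. }
  assert (H1 := Cmod_ge_0 w). assert (H2 := Cmod_ge_0 w').
  apply Rle_trans with ((1 + t * Cmod w) * (1 + t * Cmod w')).
  - apply Rmult_le_compat; try apply Cmod_ge_0; apply H.
  - assert (0 <= Cmod w * Cmod w') by now apply Rmult_le_pos.
    assert (t * t * (Cmod w * Cmod w') <= A * t * (Cmod w * Cmod w')).
    { apply Rmult_le_compat_r; [easy|]. nra. }
    nra.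
Qed.

Lemma Cinv_nonzero (z : C) : z <> RtoC 0 -> Cinv z <> RtoC 0.
Proof.
  intros Hz. apply Cmod_gt_0. rewrite Cmod_inv by easy.
  now apply Rinv_0_lt_compat, Cmod_gt_0.
Qed.

Lemma pfactor_neq_0 (a : nat -> R) (lam : nat -> C) (z : C) (n : nat) :
  z <> RtoC 0 -> z <> RtoC (a n) -> z <> lam n -> pfactor a lam z n <> RtoC 0.
Proof.
  intros Hz Hza Hzl.
  replace (pfactor a lam z n)
    with (Cmult (Cminus z (lam n)) (Cinv (Cminus z (RtoC (a n))))).
  - apply Cmult_neq_0; [now apply Cminus_neq_0|].
    apply Cinv_nonzero. now apply Cminus_neq_0.
  - unfold pfactor. field. repeat split; try easy; now apply Cminus_neq_0.
Qed.

(* Given [z], choose [z'] with [1/z + 1/z'] real and [Re (1/z') > 0]. In the product of the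
   two infinite products the conditionally convergent part (the imaginary parts of [lam])
   cancels to first order, so the moduli of its partial products stay away from 0; as the
   product at [z'] converges, the one at [z] cannot tend to 0. *)
Lemma product_limit_neq_0 (a : nat -> R) (lam : nat -> C) (f : C -> C) (z : C) :
  (forall n, 0 < a n) -> (forall n, a (S n) < a n) ->
  (forall n, fst (lam n) <= 0) ->
  ex_series a -> ex_series (fun n => Rabs (fst (lam n))) ->
  ex_series (fun n => Cmod (lam n) ^ 2) ->
  (forall z', z' <> RtoC 0 -> (forall n, z' <> RtoC (a n)) ->
    Clim (cprod (pfactor a lam z')) (f z')) ->
  z <> RtoC 0 -> (forall n, z <> RtoC (a n)) -> (forall n, z <> lam n) ->
  f z <> RtoC 0.
Proof.
  intros Hpos Hdec Hlam Ha Hre Hsq Hf Hz Hza Hzl.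
  (* [s] will be [Re (1 / z')]. Its positivity puts [z'] in the open right half-plane, away from all
     [lam n], and [s < 1 / a n] for all [n] keeps [z'] off the poles. *)
  set (s := / (2 * a O)).
  assert (Ha0 := Hpos O).
  assert (Hs : 0 < s) by (apply Rinv_0_lt_compat; lra).
  set (w := Cinv z).
  assert (Ht : exists t, t = snd w) by now exists (snd w).
  destruct Ht as [t Ht]. set (w' := (s, - t) : C).
  assert (Hw : w <> RtoC 0) by now apply Cinv_nonzero.
  assert (Hw' : w' <> RtoC 0) by (intros E; injection E; lra).
  set (z' := Cinv w').
  assert (Hww' : Cplus w w' = RtoC (fst w + s)).
  { unfold w', Cplus, RtoC. rewrite Ht. simpl. f_equal. ring. }
  assert (Hz' : z' <> RtoC 0) by now apply Cinv_nonzero.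
  assert (Hinv : forall y, z' = y -> Cmult y w' = RtoC 1).
  { intros y <-. unfold z'. now rewrite Cinv_l. }
  assert (Hza' : forall n, z' <> RtoC (a n)).
  { intros n E. apply Hinv in E. unfold w', Cmult, RtoC in E. simpl in E.
    injection E. intros _ E1.
    assert (a n <= a O).
    { destruct n as [|n]; [lra|]. left. apply (decreasing_lt a Hdec). lia. }
    assert (s * (2 * a O) = 1) by (unfold s; field; lra).
    nra. }
  assert (Hzl' : forall n, z' <> lam n).
  { intros n E. apply Hinv in E. unfold w', Cmult, RtoC in E. simpl in E.
    injection E. intros E2 E1. specialize (Hlam n).
    (* The real part of [lam n * |w'|^2 = Cconj w'], obtained from [lam n * w' = 1]. *)
    assert (fst (lam n) * (s * s + t * t) = s).
    { transitivity (s * (fst (lam n) * s - snd (lam n) * - t)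
        - t * (fst (lam n) * - t + snd (lam n) * s)); [ring|].
      rewrite E1, E2. ring. }
    nra. }
  assert (Hlim := Hf z Hz Hza). assert (Hlim' := Hf z' Hz' Hza').
  destruct (Clim_bounded _ _ Hlim') as [B [HB0 HB]].
  set (h := fun n => Rabs (fst w + s) * Rabs (fst (lam n))
                     + Cmod w * Cmod w' * Cmod (lam n) ^ 2).
  set (K := Cmod w + Cmod w' + a O * (Cmod w * Cmod w')).
  assert (Hcw := Cmod_ge_0 w). assert (Hcw' := Cmod_ge_0 w').
  assert (HK : 0 <= K).
  { unfold K. assert (0 <= Cmod w * Cmod w') by now apply Rmult_le_pos. nra. }
  assert (Hh : forall n, 0 <= h n).
  { intros n. unfold h. apply Rplus_le_le_0_compat; apply Rmult_le_pos;
      try apply Rabs_pos; [now apply Rmult_le_pos | apply pow_le, Cmod_ge_0]. }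
  assert (HKa : forall n, 0 <= K * a n).
  { intros n. apply Rmult_le_pos; [easy | left; apply Hpos]. }
  destruct (rprod_eventually_ge
    (fun n => Cmod (pfactor a lam z n) * Cmod (pfactor a lam z' n))
    (fun n => h n + K * a n)) as [c [M [Hc HM]]].
  - intros n. apply Rmult_lt_0_compat; apply Cmod_gt_0, pfactor_neq_0; auto.
  - intros n. specialize (Hh n). specialize (HKa n). lra.
  - intros n.
    assert (Hd : forall y, y <> RtoC 0 -> y <> RtoC (a n) ->
      Cminus (RtoC 1) (Cmult (RtoC (a n)) (Cinv y)) <> RtoC 0).
    { intros y Hy Hya E. apply (Cminus_neq_0 y (RtoC (a n))); [easy|].
      replace (Cminus y (RtoC (a n)))
        with (Cmult y (Cminus (RtoC 1) (Cmult (RtoC (a n)) (Cinv y)))) by (field; easy).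
      rewrite E. ring. }
    assert (Hdz := Hd z Hz (Hza n)). assert (Hdz' := Hd z' Hz' (Hza' n)).
    assert (Hp : forall y, y <> RtoC 0 -> y <> RtoC (a n) ->
      Cmod (pfactor a lam y n) = Cmod (Cminus (RtoC 1) (Cmult (lam n) (Cinv y)))
                                 / Cmod (Cminus (RtoC 1) (Cmult (RtoC (a n)) (Cinv y)))).
    { intros y Hy Hya. apply Cmod_div, Hd; easy. }
    assert (Hiz' : Cinv z' = w') by (unfold z'; field; easy).
    rewrite !Hp by easy. fold w. fold w in Hdz. rewrite Hiz' in *.
    set (n1 := Cmod (Cminus (RtoC 1) (Cmult (lam n) w))).
    set (n2 := Cmod (Cminus (RtoC 1) (Cmult (lam n) w'))).
    set (d1 := Cmod (Cminus (RtoC 1) (Cmult (RtoC (a n)) w))).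
    set (d2 := Cmod (Cminus (RtoC 1) (Cmult (RtoC (a n)) w'))).
    assert (Hd1 : 0 < d1) by now apply Cmod_gt_0.
    assert (Hd2 : 0 < d2) by now apply Cmod_gt_0.
    replace (n1 / d1 * (n2 / d2)) with ((n1 * n2) / (d1 * d2)) by (field; lra).
    apply Rdiv_ge_one_minus; auto.
    + apply Rmult_le_pos; apply Cmod_ge_0.
    + now apply Rmult_lt_0_compat.
    + now apply Cmod_one_minus_mult_ge.
    + apply Cmod_one_minus_mult_le. split; [left; apply Hpos|].
      destruct n as [|n]; [lra|]. left. apply (decreasing_lt a Hdec). lia.
  - apply (ex_series_plus h (fun n => K * a n)).
    + apply (ex_series_plus (fun n => Rabs (fst w + s) * Rabs (fst (lam n)))
        (fun n => Cmod w * Cmod w' * Cmod (lam n) ^ 2)).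
      * apply (ex_series_scal_l (Rabs (fst w + s)) _ Hre).
      * apply (ex_series_scal_l (Cmod w * Cmod w') _ Hsq).
    + apply (ex_series_scal_l K _ Ha).
  (* The paired products stay above [c] and those at [z'] below [B], so [c / B] bounds the moduli at
     [z] from below. *)
  - assert (Hle : c <= Cmod (f z) * B).
    { refine (is_lim_seq_le_loc (fun _ => c) (fun N => Cmod (cprod (pfactor a lam z) N) * B)
        (Finite c) (Finite (Cmod (f z) * B)) _ (is_lim_seq_const _) _).
      - exists M. intros N HN. apply Rle_trans with (1 := HM N HN).
        rewrite rprod_mult, <- !Cmod_cprod.
        apply Rmult_le_compat_l; [apply Cmod_ge_0 | apply HB].
      - apply is_lim_seq_mult'; [now apply Clim_Cmod | apply is_lim_seq_const]. }
    intros E. rewrite E, Cmod_0 in Hle. lra.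
Qed.

(** * Spectrum of the rank-one perturbation *)

Definition sunit (j : nat) (c : C) : nat -> C :=
  fun n => if Nat.eqb n j then c else RtoC 0.

Lemma inX_sunit (X : seqspace) (j : nat) (c : C) : valid_space X -> inX X (sunit j c).
Proof.
  intros hX. apply inX_eventually_zero with (S j); [easy|].
  intros n Hn. unfold sunit. destruct (Nat.eqb_spec n j); [lia | easy].
Qed.

Lemma shift_Tk (a : nat -> R) (b kv x : nat -> C) (z : C) (n : nat) :
  shift (Tk a b kv) z x n =
  Cplus (Cmult (Cminus (RtoC (a n)) z) (x n)) (Cmult (funct kv x) (b n)).
Proof.
  unfold shift, Tk. change (csum (fun m => Cmult (kv m) (x m))) with (funct kv x). ring.
Qed.

Lemma spectrum_eigenvector (X : seqspace) (a : nat -> R) (b kv x : nat -> C) (z : C) (n : nat) :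
  valid_space X -> inX X x -> x n <> RtoC 0 ->
  (forall m, shift (Tk a b kv) z x m = RtoC 0) -> spectrum X (Tk a b kv) z.
Proof.
  intros hX Hx Hn H [T [_ [_ [HT _]]]]. apply Hn.
  (* The zero vector, written as a multiple of a unit vector so that [funct_unit] evaluates the
     functional on it. *)
  set (x0 := sunit 0 (RtoC 0)).
  assert (Hx0 : forall m, x0 m = RtoC 0).
  { intros m. unfold x0, sunit. now destruct (Nat.eqb m 0). }
  assert (E : shift (Tk a b kv) z x = shift (Tk a b kv) z x0).
  { apply functional_extensionality. intros m. rewrite H, shift_Tk, Hx0.
    replace (funct kv x0) with (Cmult (kv O) (RtoC 0)) by (symmetry; apply funct_unit).
    ring. }
  rewrite <- (HT x Hx), E, HT, Hx0; [easy|]. now apply inX_sunit.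
Qed.

(** An inverse with bound [M], applied to the image of a vector killed by [k], would give
    [1 <= M * a n] for every [n], contradicting [a n -> 0]. *)
Lemma spectrum_zero (X : seqspace) (a : nat -> R) (b kv : nat -> C) :
  valid_space X -> (forall n, 0 < a n) -> (forall n, a (S n) < a n) ->
  is_lim_seq a 0 -> in_dual X kv -> (forall n, kv n <> RtoC 0) ->
  spectrum X (Tk a b kv) (RtoC 0).
Proof.
  intros hX Hpos Hdec Hlim Hd Hk0 [T [_ [[M HM] [HT _]]]].
  assert (H : forall n, 1 <= M * a n).
  { intros n.
    (* The coefficients are crossed so that [k x = 0]; they are nonzero, so [x] is not the zero
       vector. *)
    set (x := splus (sunit n (kv (S n))) (sunit (S n) (Copp (kv n)))).
    assert (Hx : inX X x) by (apply inX_plus; auto using inX_sunit).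
    assert (Hkx : funct kv x = RtoC 0).
    { unfold x. rewrite (funct_plus X) by auto using inX_sunit.
      unfold sunit. rewrite !funct_unit. ring. }
    set (y := shift (Tk a b kv) (RtoC 0) x).
    assert (Hyn : forall m, y m = Cmult (RtoC (a m)) (x m)).
    { intros m. unfold y. rewrite shift_Tk, Hkx. ring. }
    assert (Hy : inX X y).
    { apply inX_eventually_zero with (S (S n)); [easy|]. intros m Hm.
      rewrite Hyn. unfold x, splus, sunit.
      destruct (Nat.eqb_spec m n); [lia|]. destruct (Nat.eqb_spec m (S n)); [lia|]. ring. }
    assert (Hny : normX X y <= a n * normX X x).
    { apply normX_le_scal; try easy; [left; apply Hpos|]. intros m.
      rewrite Hyn, Cmod_mult, Cmod_R, Rabs_pos_eq by (left; apply Hpos).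
      destruct (Nat.lt_ge_cases m n) as [Hm|Hm].
      - replace (x m) with (RtoC 0); [rewrite Cmod_0; lra|].
        unfold x, splus, sunit.
        destruct (Nat.eqb_spec m n); [lia|]. destruct (Nat.eqb_spec m (S n)); [lia|]. ring.
      - apply Rmult_le_compat_r; [apply Cmod_ge_0|].
        destruct (Nat.eq_dec m n) as [->|Hmn]; [lra|].
        left. apply (decreasing_lt a Hdec). lia. }
    assert (Hnx : 0 < normX X x).
    { apply Rlt_le_trans with (2 := normX_ge_coord X x n hX Hx).
      apply Cmod_gt_0. unfold x, splus, sunit. rewrite Nat.eqb_refl.
      destruct (Nat.eqb_spec n (S n)); [lia|]. rewrite Cplus_0_r. apply Hk0. }
    assert (HMy := HM y Hy). unfold y in HMy at 1. rewrite (HT x Hx) in HMy.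
    assert (Hny0 := normX_ge_0 X y hX Hy). assert (Han := Hpos n).
    assert (HM0 : 0 <= M) by nra.
    apply Rmult_le_reg_r with (normX X x); [easy|].
    apply Rle_trans with (M * normX X y); [lra|].
    rewrite Rmult_assoc. now apply Rmult_le_compat_l. }
  assert (Hl : is_lim_seq (fun n => M * a n) (M * 0))
    by apply (is_lim_seq_scal_l a M 0 Hlim).
  assert (Hle := is_lim_seq_le _ _ (Finite 1) (Finite (M * 0)) H (is_lim_seq_const 1) Hl).
  simpl in Hle. lra.
Qed.

(** The common shape of both inverses constructed below: a multiplication operator plus two rank-one
    terms. Regular points use one of these terms, the poles [a_j] both. *)
Definition rank2_pert (d v w : nat -> C) (phi psi : (nat -> C) -> C) (y : nat -> C) :
  nat -> C :=
  splus (smult d y) (splus (sscal (phi y) v) (sscal (psi y) w)).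

Definition bounded_form (X : seqspace) (phi : (nat -> C) -> C) : Prop :=
  exists M, 0 <= M /\ forall y, inX X y -> Cmod (phi y) <= M * normX X y.

Lemma smult_bounded (X : seqspace) (d : nat -> C) (l : C) :
  valid_space X -> Clim d l ->
  exists M, 0 <= M /\ forall y, inX X y -> normX X (smult d y) <= M * normX X y.
Proof.
  intros hX Hd. destruct (Clim_bounded d l Hd) as [M [HM0 HM]].
  exists M. split; [easy|]. intros y Hy. apply normX_le_scal; try easy.
  intros n. unfold smult. rewrite Cmod_mult.
  apply Rmult_le_compat_r; [apply Cmod_ge_0 | apply HM].
Qed.

Lemma sscal_norm (X : seqspace) (c : C) (x : nat -> C) :
  valid_space X -> inX X x -> normX X (sscal c x) <= Cmod c * normX X x.
Proof.
  intros hX Hx. apply normX_le_scal; try easy; [apply Cmod_ge_0|].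
  intros n. unfold sscal. rewrite Cmod_mult. lra.
Qed.

Lemma rank2_pert_bounded (X : seqspace) (d v w : nat -> C) (l : C)
  (phi psi : (nat -> C) -> C) :
  valid_space X -> Clim d l -> inX X v -> inX X w ->
  bounded_form X phi -> bounded_form X psi ->
  (forall y, inX X y -> inX X (rank2_pert d v w phi psi y)) /\
  exists M, forall y, inX X y ->
    normX X (rank2_pert d v w phi psi y) <= M * normX X y.
Proof.
  intros hX Hd Hv Hw [M1 [HM1 H1]] [M2 [HM2 H2]].
  split.
  - intros y Hy. repeat apply inX_plus; auto using inX_scal.
    now apply inX_Clim_mult with l.
  - destruct (normX_quasi_triangle X hX) as [K [HK HT]].
    destruct (smult_bounded X d l hX Hd) as [M [HM HB]].
    exists (K * (M + K * (M1 * normX X v + M2 * normX X w))). intros y Hy.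
    assert (Hv0 := normX_ge_0 X v hX Hv). assert (Hw0 := normX_ge_0 X w hX Hw).
    assert (Hp : normX X (sscal (phi y) v) <= M1 * normX X y * normX X v).
    { apply Rle_trans with (1 := sscal_norm X (phi y) v hX Hv).
      apply Rmult_le_compat_r; auto. }
    assert (Hq : normX X (sscal (psi y) w) <= M2 * normX X y * normX X w).
    { apply Rle_trans with (1 := sscal_norm X (psi y) w hX Hw).
      apply Rmult_le_compat_r; auto. }
    assert (Hpq := HT _ _ (inX_scal X (phi y) v hX Hv) (inX_scal X (psi y) w hX Hw)).
    assert (Hall := HT _ _ (inX_Clim_mult X d y l hX Hd Hy)
      (inX_plus X _ _ hX (inX_scal X (phi y) v hX Hv) (inX_scal X (psi y) w hX Hw))).
    apply Rle_trans with (1 := Hall).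
    rewrite Rmult_assoc. apply Rmult_le_compat_l; [easy|].
    rewrite Rmult_plus_distr_r. apply Rplus_le_compat; [now apply HB|].
    apply Rle_trans with (1 := Hpq). rewrite Rmult_assoc.
    apply Rmult_le_compat_l; [easy|]. lra.
Qed.

Lemma bounded_form_funct_smult (X : seqspace) (kv d : nat -> C) (l : C) :
  valid_space X -> in_dual X kv -> Clim d l ->
  bounded_form X (fun y => funct kv (smult d y)).
Proof.
  intros hX Hk Hd. destruct (funct_bounded X kv hX Hk) as [M [HM0 HM]].
  destruct (smult_bounded X d l hX Hd) as [K [HK0 HK]].
  exists (M * K). split; [now apply Rmult_le_pos|]. intros y Hy.
  apply Rle_trans with (1 := HM _ (inX_Clim_mult X d y l hX Hd Hy)).
  rewrite Rmult_assoc. apply Rmult_le_compat_l; auto.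
Qed.

Lemma bounded_form_coord (X : seqspace) (j : nat) :
  valid_space X -> bounded_form X (fun y => y j).
Proof.
  intros hX. exists 1. split; [lra|]. intros y Hy. rewrite Rmult_1_l.
  now apply normX_ge_coord.
Qed.

Lemma bounded_form_scal (X : seqspace) (c : C) (phi : (nat -> C) -> C) :
  bounded_form X phi -> bounded_form X (fun y => Cmult c (phi y)).
Proof.
  intros [M [HM0 HM]]. exists (Cmod c * M). split.
  - apply Rmult_le_pos; [apply Cmod_ge_0 | easy].
  - intros y Hy. rewrite Cmod_mult, Rmult_assoc.
    apply Rmult_le_compat_l; [apply Cmod_ge_0 | auto].
Qed.

Lemma bounded_form_plus (X : seqspace) (phi psi : (nat -> C) -> C) :
  bounded_form X phi -> bounded_form X psi ->
  bounded_form X (fun y => Cplus (phi y) (psi y)).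
Proof.
  intros [M [HM0 HM]] [K [HK0 HK]]. exists (M + K). split; [lra|].
  intros y Hy. rewrite Rmult_plus_distr_r.
  apply Rle_trans with (1 := Cmod_triangle _ _). apply Rplus_le_compat; auto.
Qed.

Lemma funct_rank2_pert (X : seqspace) (kv d v w y : nat -> C) (l : C)
  (phi psi : (nat -> C) -> C) :
  valid_space X -> in_dual X kv -> Clim d l -> inX X v -> inX X w -> inX X y ->
  funct kv (rank2_pert d v w phi psi y) =
  Cplus (funct kv (smult d y))
    (Cplus (Cmult (phi y) (funct kv v)) (Cmult (psi y) (funct kv w))).
Proof.
  intros hX Hk Hd Hv Hw Hy. unfold rank2_pert.
  rewrite !(funct_plus X), !(funct_scal X); auto using inX_plus, inX_scal.
  now apply inX_Clim_mult with l.
Qed.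

(** Sherman-Morrison: with [R = (A - z)^-1] and [f = 1 + k R b], the inverse is
    [R y - (k R y / f) R b]. The second rank-one term is set to zero. *)
Lemma not_spectrum_regular (X : seqspace) (a : nat -> R) (b kv : nat -> C) (z : C) :
  valid_space X -> is_lim_seq a 0 -> inX X b -> in_dual X kv ->
  z <> RtoC 0 -> (forall n, z <> RtoC (a n)) ->
  Cplus (RtoC 1) (funct kv (resolv a b z)) <> RtoC 0 ->
  ~ spectrum X (Tk a b kv) z.
Proof.
  intros hX Hlim Hb Hd Hz Hza Hf Hsp. apply Hsp.
  assert (Hr := resolvent_Clim a z Hlim Hz Hza).
  set (r := fun n => Cinv (Cminus (RtoC (a n)) z)) in *.
  set (v := smult r b). change (resolv a b z) with v in Hf.
  set (f := Cplus (RtoC 1) (funct kv v)) in *.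
  assert (Hv : inX X v) by now apply inX_Clim_mult with (Cinv (Cminus (RtoC 0) z)).
  set (phi := fun y => Cmult (Copp (Cinv f)) (funct kv (smult r y))).
  set (psi := fun y : nat -> C => Cmult (RtoC 0) (y O)).
  assert (Hazn : forall n, Cminus (RtoC (a n)) z <> RtoC 0).
  { intros n. apply Cminus_neq_0. intros E. now apply (Hza n). }
  exists (rank2_pert r v v phi psi).
  destruct (rank2_pert_bounded X r v v _ phi psi hX Hr Hv Hv) as [H1 H2].
  { apply bounded_form_scal. now apply bounded_form_funct_smult with (2 := Hd) (3 := Hr). }
  { now apply bounded_form_scal, bounded_form_coord. }
  repeat split; try easy.
  - intros x Hx.
    assert (E : smult r (shift (Tk a b kv) z x) = splus x (sscal (funct kv x) v)).
    { apply functional_extensionality. intros n. unfold smult at 1, splus, sscal, v, smult.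
      rewrite shift_Tk. unfold r. field. apply Hazn. }
    assert (Ep : phi (shift (Tk a b kv) z x) = Copp (funct kv x)).
    { unfold phi. rewrite E, (funct_plus X), (funct_scal X) by auto using inX_scal.
      replace (Cplus (funct kv x) (Cmult (funct kv x) (funct kv v)))
        with (Cmult (funct kv x) f) by (unfold f; ring).
      field. exact Hf. }
    unfold rank2_pert. rewrite E, Ep. apply functional_extensionality. intros n.
    unfold splus, sscal, psi. ring.
  - intros y Hy. apply functional_extensionality. intros n.
    rewrite shift_Tk, (funct_rank2_pert X) with (3 := Hr) by auto.
    unfold rank2_pert, splus, sscal, psi, phi.
    change (smult r y n) with (Cmult (Cinv (Cminus (RtoC (a n)) z)) (y n)).
    change (v n) with (Cmult (Cinv (Cminus (RtoC (a n)) z)) (b n)).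
    replace (funct kv v) with (Cminus f (RtoC 1)) by (unfold f; ring).
    field. split; [exact Hf | apply Hazn].
Qed.

(** Solve [(A + bk - a_j) x = y]. Coordinate [j] reads [(k x) b_j = y_j] and determines [k x]; the
    others then give [x_n] for [n <> j]; finally [x_j] is recovered from the value of [k x], by
    division by [k_j]. Thus [phi y = - k x] and [psi y = x_j]. *)
Lemma not_spectrum_pole (X : seqspace) (a : nat -> R) (b kv : nat -> C) (j : nat) :
  valid_space X -> is_lim_seq a 0 -> (forall n, 0 < a n) ->
  (forall m n, a m = a n -> m = n) -> inX X b -> in_dual X kv ->
  b j <> RtoC 0 -> kv j <> RtoC 0 ->
  ~ spectrum X (Tk a b kv) (RtoC (a j)).
Proof.
  intros hX Hlim Hpos Hinj Hb Hd Hbj Hkj Hsp. apply Hsp.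
  set (z := RtoC (a j)) in *.
  assert (Hz : z <> RtoC 0) by (apply RtoC_neq; specialize (Hpos j); lra).
  assert (Hzn : forall n, n <> j -> Cminus (RtoC (a n)) z <> RtoC 0).
  { intros n Hn. apply Cminus_neq_0, RtoC_neq. intros E. now apply Hn, Hinj. }
  (* [g] replaces the vanishing entry by 1 so that [Clim_inv] applies, while the actual multiplier
     [d] is 0 there; the two choices have the same limit. *)
  set (g := fun n => if Nat.eqb n j then RtoC 1 else Cminus (RtoC (a n)) z).
  set (d := fun n => if Nat.eqb n j then RtoC 0 else Cinv (Cminus (RtoC (a n)) z)).
  assert (Hdl : Clim d (Cinv (Cminus (RtoC 0) z))).
  { apply Clim_ext_loc with (fun n => Cinv (g n)).
    - exists (S j). intros n Hn. unfold g, d. destruct (Nat.eqb_spec n j); [lia | easy].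
    - apply Clim_inv.
      + apply Cminus_neq_0. congruence.
      + intros n. unfold g. destruct (Nat.eqb_spec n j); [apply RtoC_neq; lra | auto].
      + apply Clim_ext_loc with (fun n => Cminus (RtoC (a n)) z).
        * exists (S j). intros n Hn. unfold g. destruct (Nat.eqb_spec n j); [lia | easy].
        * apply (Clim_plus (fun n => RtoC (a n)) (fun _ => Copp z)); [|apply Clim_const].
          apply Clim_components; simpl; [exact Hlim | apply is_lim_seq_const]. }
  assert (Hdj : d j = RtoC 0) by (unfold d; now rewrite Nat.eqb_refl).
  assert (Hdn : forall n, n <> j -> d n = Cinv (Cminus (RtoC (a n)) z)).
  { intros n Hn. unfold d. destruct (Nat.eqb_spec n j); easy. }
  set (v := smult d b).
  assert (Hv : inX X v) by now apply inX_Clim_mult with (2 := Hdl).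
  set (w := sunit j (RtoC 1)).
  assert (Hw : inX X w) by now apply inX_sunit.
  assert (Hwj : w j = RtoC 1) by (unfold w, sunit; now rewrite Nat.eqb_refl).
  assert (Hwn : forall n, n <> j -> w n = RtoC 0).
  { intros n Hn. unfold w, sunit. destruct (Nat.eqb_spec n j); easy. }
  assert (Hkw : funct kv w = kv j).
  { unfold w, sunit. rewrite funct_unit. ring. }
  set (phi := fun y : nat -> C => Cmult (Copp (Cinv (b j))) (y j)).
  set (psi := fun y : nat -> C =>
    Cplus (Cmult (Cmult (Cinv (kv j)) (Cmult (Cinv (b j)) (Cplus (RtoC 1) (funct kv v)))) (y j))
      (Cmult (Copp (Cinv (kv j))) (funct kv (smult d y)))).
  exists (rank2_pert d v w phi psi).
  destruct (rank2_pert_bounded X d v w _ phi psi hX Hdl Hv Hw) as [H1 H2].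
  { now apply bounded_form_scal, bounded_form_coord. }
  { apply bounded_form_plus; apply bounded_form_scal;
      [now apply bounded_form_coord | now apply bounded_form_funct_smult with (2 := Hd) (3 := Hdl)]. }
  repeat split; try easy.
  - intros x Hx.
    set (y := shift (Tk a b kv) z x).
    assert (Hyj : y j = Cmult (funct kv x) (b j)).
    { unfold y. rewrite shift_Tk. unfold z. ring. }
    assert (E : smult d y = splus x (splus (sscal (funct kv x) v) (sscal (Copp (x j)) w))).
    { apply functional_extensionality. intros n. unfold smult, splus, sscal.
      destruct (Nat.eq_dec n j) as [->|Hn].
      - unfold v, smult. rewrite Hdj, Hwj. ring.
      - unfold v, smult. rewrite (Hdn n Hn), (Hwn n Hn). unfold y. rewrite shift_Tk.
        field. now apply Hzn. }
    assert (Ep : phi y = Copp (funct kv x)).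
    { unfold phi. rewrite Hyj. field. exact Hbj. }
    assert (Eq : psi y = x j).
    { unfold psi. rewrite E, !(funct_plus X), !(funct_scal X)
        by auto using inX_scal, inX_plus.
      rewrite Hyj, Hkw. field. easy. }
    unfold rank2_pert. rewrite E, Ep, Eq. apply functional_extensionality. intros n.
    unfold splus, sscal. ring.
  - intros y Hy. apply functional_extensionality. intros n.
    rewrite shift_Tk, (funct_rank2_pert X) with (3 := Hdl) by auto.
    rewrite Hkw.
    replace (Cplus (funct kv (smult d y))
      (Cplus (Cmult (phi y) (funct kv v)) (Cmult (psi y) (kv j))))
      with (Cmult (Cinv (b j)) (y j)) by (unfold phi, psi; field; easy).
    unfold rank2_pert, splus, sscal, v, smult.
    destruct (Nat.eq_dec n j) as [->|Hn].
    + unfold z. field. easy.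
    + rewrite (Hdn n Hn), (Hwn n Hn). unfold phi. field. split; [easy | now apply Hzn].
Qed.

Theorem theorem2
  (X : seqspace) (hX : valid_space X)
  (a : nat -> R) (b lam kv : nat -> C)
  (ha_pos : forall n, 0 < a n)
  (ha_dec : forall n, a (S n) < a n)
  (ha_lim : is_lim_seq a 0)
  (hbX : inX X b) (hb0 : forall n, b n <> RtoC 0)
  (hlam0 : inX Czero lam) (hlamH : forall n, fst (lam n) <= 0)
  (hk : is_kseq a b lam kv)
  (hkdual : in_dual X kv) :
  forall z : C, spectrum X (Tk a b kv) z <-> (z = RtoC 0 \/ exists n, z = lam n).
Proof.
  assert (Hal : forall n m, RtoC (a n) <> lam m).
  { intros n m E. specialize (ha_pos n). specialize (hlamH m). rewrite <- E in hlamH.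
    simpl in hlamH. lra. }
  assert (Hkv : forall n, kv n <> RtoC 0).
  { intros n. destruct (hk n) as [P [HP ->]]. apply Clim_filterlim in HP.
    apply Cmult_neq_0; [|now apply kpartial_limit_neq_0 with a lam n].
    replace (Copp (Cdiv (Cminus (RtoC (a n)) (lam n)) (b n)))
      with (Cmult (Cminus (lam n) (RtoC (a n))) (Cinv (b n))) by (field; apply hb0).
    apply Cmult_neq_0; [apply Cminus_neq_0; intros E; now apply (Hal n n)|].
    apply Cinv_nonzero, hb0. }
  set (f := fun z => Cplus (RtoC 1) (funct kv (resolv a b z))).
  assert (Hf : forall z, z <> RtoC 0 -> (forall n, z <> RtoC (a n)) ->
    Clim (cprod (pfactor a lam z)) (f z)).
  { intros z Hz Hza. now apply product_limit with X. }
  intros z. split.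
  - intros Hsp. apply NNPP. intros Hn.
    assert (Hz : z <> RtoC 0) by tauto.
    assert (Hzl : forall n, z <> lam n) by (intros n E; apply Hn; right; now exists n).
    destruct (classic (exists j, z = RtoC (a j))) as [[j ->]|Hza].
    + revert Hsp. apply not_spectrum_pole; auto. now apply decreasing_inj.
    + assert (Hza' : forall n, z <> RtoC (a n)) by (intros n E; apply Hza; now exists n).
      destruct (hk O) as [P [HP _]]. apply Clim_filterlim in HP.
      destruct (kpartial_summability a lam P ha_pos ha_dec hlamH HP) as [S1 [S2 S3]].
      revert Hsp. apply not_spectrum_regular; auto.
      now apply (product_limit_neq_0 a lam f z).
  - intros Hz. destruct (classic (z = RtoC 0)) as [->|Hz0].
    { now apply spectrum_zero. }
    destruct Hz as [Hz|[j ->]]; [easy|].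
    assert (Hza : forall n, lam j <> RtoC (a n)) by (intros n E; now apply (Hal n j)).
    assert (Hf0 : f (lam j) = RtoC 0).
    { apply Clim_zero_unique with (1 := Hf _ Hz0 Hza).
      apply Clim_ext_loc with (fun _ => RtoC 0); [|apply Clim_const].
      exists (S j). intros N HN. symmetry. now apply cprod_pfactor_zero. }
    assert (Hd0 : forall n, Cminus (RtoC (a n)) (lam j) <> RtoC 0)
      by (intros n; apply Cminus_neq_0, Hal).
    (* Since [(A - z) (A - z)^-1 b = b], the operator [A + bk - z] sends this vector to [f z] times
       [b], which is zero at [z = lam j]. Its coordinate 0 is nonzero because [b 0] is. *)
    apply spectrum_eigenvector with (resolv a b (lam j)) O; auto.
    + apply (inX_Clim_mult X _ b _ hX (resolvent_Clim a (lam j) ha_lim Hz0 Hza) hbX).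
    + apply Cmult_neq_0; [apply Cinv_nonzero, Hd0 | apply hb0].
    + intros n. rewrite shift_Tk.
      replace (funct kv (resolv a b (lam j))) with (Cminus (f (lam j)) (RtoC 1))
        by (unfold f; ring).
      rewrite Hf0. unfold resolv, smult. field. apply Hd0.
Qed.
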